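(* Let $\mathbb{X}=[X_1\rightrightarrows X_0]$ be a Lie groupoid. There is a groupoid $\Pi_{\mathrm{thin}}(\mathbb{X})$ with object set $X_0$ and morphism set $\frac{P\mathbb{X}}{\sim}$ (lazy $\mathbb{X}$-paths modulo lazy $\mathbb{X}$-path thin homotopy), whose structure maps are: (i) source: $[(\gamma_0,\alpha_1,\gamma_1,\dots,\alpha_n,\gamma_n)]\mapsto s(\gamma_0)$; (ii) target: $[(\gamma_0,\alpha_1,\gamma_1,\dots,\alpha_n,\gamma_n)]\mapsto t(\gamma_n)$; (iii) composition: if $s([(\gamma'_0,\alpha'_1,\gamma'_1,\dots,\alpha'_n,\gamma'_n)])=t([(\gamma_0,\alpha_1,\gamma_1,\dots,\alpha_m,\gamma_m)])$, then $$[(\gamma'_0,\alpha'_1,\gamma'_1,\dots,\alpha'_n,\gamma'_n)]\circ[(\gamma_0,\alpha_1,\gamma_1,\dots,\alpha_m,\gamma_m)]=[(\gamma_0,\alpha_1,\gamma_1,\dots,\alpha_m,\gamma'_0\circ\gamma_m,\alpha'_1,\gamma'_1,\dots,\alpha'_n,\gamma'_n)];$$ (iv) unit: $x\mapsto[(1_x,c_x,1_x)]$, where $c_x:[0,1]\to X_0$ is the constant path at $x$; (v) inverse: $[(\gamma_0,\alpha_1,\gamma_1,\dots,\gamma_{n-1},\alpha_n,\gamma_n)]\mapsto[(\gamma_n^{-1},\alpha_n^{-1},\gamma_{n-1}^{-1},\dots,\gamma_1^{-1},\alpha_1^{-1},\gamma_0^{-1})]$.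
   Context: In a Lie groupoid $\mathbb{X}=[X_1\rightrightarrows X_0]$ the source and target are $s,t$, the unit is $u:x\mapsto 1_x$, and $\gamma_2\circ\gamma_1$ is defined when $t(\gamma_1)=s(\gamma_2)$. A path with sitting instants in a manifold $M$ is a smooth map $\alpha:[0,1]\to M$ for which there is $\epsilon\in(0,1/2)$ with $\alpha$ constant on $[0,\epsilon)$ and on $(1-\epsilon,1]$; $\alpha^{-1}(r)=\alpha(1-r)$; and $\beta*\alpha$ is the concatenation, first $\alpha$ and then $\beta$. Two such paths $\alpha,\beta$ from $x$ to $y$ are thin homotopic if there is a smooth $H:[0,1]^2\to M$ whose differential has rank at most $1$ everywhere and an $\epsilon\in(0,1/2)$ such that $H(r,r')=x$ for $r'\in[0,\epsilon)$, $H(r,r')=y$ for $r'\in(1-\epsilon,1]$, $H(r,r')=\alpha(r')$ for $r\in[0,\epsilon)$, and $H(r,r')=\beta(r')$ for $r\in(1-\epsilon,1]$. A lazy $\mathbb{X}$-path of order $n\geq 0$ from $x$ to $y$ is a sequence $\Gamma=(\gamma_0,\alpha_1,\gamma_1,\dots,\alpha_n,\gamma_n)$ with $\gamma_i\in X_1$ and $\alpha_i$ paths with sitting instants in $X_0$, such that $s(\gamma_0)=x$, $t(\gamma_n)=y$, $s(\gamma_i)=\alpha_i(1)$ for $0<i\le n$, and $t(\gamma_i)=\alpha_{i+1}(0)$ for $0\le i<n$. $P\mathbb{X}$ is the set of all lazy $\mathbb{X}$-paths of all orders. Two lazy $\mathbb{X}$-paths are equivalent if one is obtained from the other by finitely many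 of the following operations. (1) Removing or adding a constant path: if $\alpha_{i+1}$ is constant, $i\in\{0,\dots,n-1\}$, replace $\gamma_i,\alpha_{i+1},\gamma_{i+1}$ by $\gamma_{i+1}\circ\gamma_i$; or the reverse. (2) Removing or adding an identity: if $\gamma_i$ is an identity, $i\in\{1,\dots,n-1\}$, replace $\alpha_i,\gamma_i,\alpha_{i+1}$ by $\alpha_{i+1}*\alpha_i$; or the reverse. (3) For a path with sitting instants $\zeta_i:[0,1]\to X_1$ with $s\circ\zeta_i=\alpha_i$, $i\in\{1,\dots,n\}$, replace $\gamma_{i-1},\alpha_i,\gamma_i$ by $\zeta_i(0)\circ\gamma_{i-1},\ t\circ\zeta_i,\ \gamma_i\circ\zeta_i(1)^{-1}$. A thin deformation from $\Gamma=(\gamma_0,\alpha_1,\dots,\alpha_n,\gamma_n)$ to $\Gamma'=(\gamma'_0,\alpha'_1,\dots,\alpha'_n,\gamma'_n)$ (same order) is a family of paths with sitting instants $\zeta_i:[0,1]\to X_1$, $i=0,\dots,n$, with $\zeta_i(0)=\gamma_i$ and $\zeta_i(1)=\gamma'_i$, such that $\alpha_i$ is thin homotopic to $(s\circ\zeta_i)^{-1}*\alpha'_i*(t\circ\zeta_{i-1})$ for $i=1,\dots,n$, and $s\circ\zeta_0$ and $t\circ\zeta_n$ are constant. Lazy $\mathbb{X}$-path thin homotopy $\sim$ is the equivalence relation on $P\mathbb{X}$ generated by equivalence and thin deformation: two lazy $\mathbb{X}$-paths are related iff one is obtained from the other by a finite sequence of operations (1)-(3) and thin deformations. *)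

(* Defs.v *)
From HB Require Import structures.
From Stdlib Require Import Relation_Operators.
From mathcomp Require Import all_boot all_order all_algebra.
From mathcomp Require Import generic_quotient.
From mathcomp Require Import boolp classical_sets functions reals.
From mathcomp Require Import topology normedtype derive.

Set Implicit Arguments.
Unset Strict Implicit.
Unset Printing Implicit Defensive.

Import Order.TTheory GRing.Theory Num.Theory.
Import numFieldNormedType.Exports.

Local Open Scope ring_scope.
Local Open Scope classical_set_scope.
Local Open Scope quotient_scope.

(* Smooth maps between open subsets of finite-dimensional normed spaces: the
   model spaces used below are R, R^n, and finite products of these. *)
Fixpoint Ck (R : realType) (E F : normedModType R) (k : nat) (U : set E)
    (f : E -> F) : Prop :=
  if k is k'.+1 then
    (forall x, U x -> differentiable f x) /\
    (forall v : E, Ck k' U (fun x => 'D_v f x))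
  else forall x, U x -> {for x, continuous f}.

Definition smooth_on (R : realType) (E F : normedModType R) (U : set E)
  (f : E -> F) : Prop := forall k, Ck k U f.

Lemma Ck_cst (R : realType) (E F : normedModType R) k (U : set E) (c : F) :
  Ck k U (fun=> c).
Proof.
elim: k c => [|k IH] c /=; first by move=> x _; exact: cst_continuous.
split=> [x _|v]; first exact: differentiable_cst.
have -> : (fun x : E => 'D_v (fun=> c) x) = (fun=> 0 : F).
  by apply/funext => x; exact: derive_cst.
exact: IH.
Qed.

(* A chart: a homeomorphism from an open subset of T onto an open subset of the
   model space E.  The two maps are total; their values outside the stated
   domains are irrelevant. *)
Record chart (R : realType) (E : normedModType R) (T : topologicalType) :=
  Chart {
    chart_dom : set T;
    chart_cod : set E;
    chart_map :> T -> E;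
    chart_inv : E -> T;
    chart_dom_open : open chart_dom;
    chart_cod_open : open chart_cod;
    chart_mapP : forall x, chart_dom x -> chart_cod (chart_map x);
    chart_invP : forall y, chart_cod y -> chart_dom (chart_inv y);
    chart_mapK : forall x, chart_dom x -> chart_inv (chart_map x) = x;
    chart_invK : forall y, chart_cod y -> chart_map (chart_inv y) = y;
    chart_map_cont : forall x, chart_dom x -> {for x, continuous chart_map};
    chart_inv_cont : forall y, chart_cod y -> {for y, continuous chart_inv}
  }.

Record charted (R : realType) (E : normedModType R) := Charted {
  charted_sort :> topologicalType;
  atlas : set (chart E charted_sort);
  atlas_cover : forall x, exists2 phi, atlas phi & chart_dom phi x
}.

Record manifold (R : realType) := Manifold {
  mdim : nat;
  manifold_charted :> charted 'rV[R]_mdim;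
  manifold_hausdorff : hausdorff_space manifold_charted;
  manifold_second_countable : @second_countable manifold_charted;
  manifold_compatible : forall phi psi : chart 'rV[R]_mdim manifold_charted,
    atlas phi -> atlas psi ->
    smooth_on (chart_cod phi `&` (chart_inv phi @^-1` chart_dom psi))
              (psi \o chart_inv phi)
}.

Section Products.
Variables (R : realType).

#[local] Obligation Tactic := idtac.

Section ProdChart.
Variables (E F : normedModType R) (M N : topologicalType).
Variables (phi : chart E M) (psi : chart F N).

Let pdom : set (M * N) := chart_dom phi `*` chart_dom psi.
Let pcod : set (E * F) := chart_cod phi `*` chart_cod psi.
Let pmap (x : M * N) : E * F := (phi x.1, psi x.2).
Let pinv (y : E * F) : M * N := (chart_inv phi y.1, chart_inv psi y.2).

Let openX (S T : topologicalType) (A : set S) (B : set T) :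
  open A -> open B -> open (A `*` B).
Proof.
move=> oA oB; rewrite openE => -[a b] [/= Aa Bb].
by exists (A, B) => //=; split; apply: open_nbhs_nbhs.
Qed.

Let pair_cont (S S' T T' : topologicalType) (f : S -> S') (g : T -> T')
    (x : S * T) :
  {for x.1, continuous f} -> {for x.2, continuous g} ->
  {for x, continuous (fun x : S * T => (f x.1, g x.2))}.
Proof.
move=> fx gx; apply: cvg_pair => /=.
  by apply: (cvg_comp fst f _ fx); exact: cvg_fst.
by apply: (cvg_comp snd g _ gx); exact: cvg_snd.
Qed.

Program Definition prod_chart : chart (E * F)%type (M * N)%type :=
  @Chart R (E * F)%type (M * N)%type pdom pcod pmap pinv _ _ _ _ _ _ _ _.
Next Obligation. by apply: openX; exact: chart_dom_open. Qed.
Next Obligation. by apply: openX; exact: chart_cod_open. Qed.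
Next Obligation. by move=> x [? ?]; split; exact: chart_mapP. Qed.
Next Obligation. by move=> x [? ?]; split; exact: chart_invP. Qed.
Next Obligation. by move=> [x y] [? ?]; rewrite /pinv /pmap/= !chart_mapK. Qed.
Next Obligation. by move=> [x y] [? ?]; rewrite /pinv /pmap/= !chart_invK. Qed.
Next Obligation.
by move=> x [? ?]; apply: pair_cont; exact: chart_map_cont.
Qed.
Next Obligation.
by move=> x [? ?]; apply: pair_cont; exact: chart_inv_cont.
Qed.

End ProdChart.

Program Definition prod_charted (E F : normedModType R) (M : charted E)
    (N : charted F) : charted (E * F)%type :=
  @Charted R (E * F)%type (M * N)%type
    [set prod_chart phi psi | phi in @atlas _ _ M & psi in @atlas _ _ N] _.
Next Obligation.
move=> E F M N [x y].
have [phi aphi phix] := atlas_cover x; have [psi apsi psiy] := atlas_cover y.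
by exists (prod_chart phi psi) => //; exists phi => //; exists psi.
Qed.

Program Definition id_chart (E : normedModType R) : chart E E :=
  @Chart R E E setT setT id id openT openT _ _ _ _ _ _.
Next Obligation. by []. Qed.
Next Obligation. by []. Qed.
Next Obligation. by []. Qed.
Next Obligation. by []. Qed.
Next Obligation. by move=> E x _; exact: cvg_id. Qed.
Next Obligation. by move=> E x _; exact: cvg_id. Qed.

Program Definition model_charted (E : normedModType R) : charted E :=
  @Charted R E E [set id_chart E] _.
Next Obligation. by move=> E x; exists (id_chart E). Qed.

Definition line : charted R^o := model_charted R^o.

End Products.

Section SmoothMaps.
Variables (R : realType) (E F : normedModType R) (M : charted E) (N : charted F).

Definition local_rep (phi : chart E M) (psi : chart F N) (f : M -> N) : E -> F :=
  psi \o f \o chart_inv phi.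

Definition chart_at (G : normedModType R) (P : charted G) (p : P)
  (phi : chart G P) : Prop := atlas phi /\ chart_dom phi p.

(* f is smooth on some neighbourhood of p *)
Definition smooth_at (f : M -> N) (p : M) : Prop :=
  {for p, continuous f} /\
  exists phi psi, [/\ chart_at p phi, chart_at (f p) psi &
    exists2 U, open_nbhs (phi p) U & smooth_on U (local_rep phi psi f)].

Definition smooth (f : M -> N) : Prop := forall p, smooth_at f p.

Definition submersion (f : M -> N) : Prop := smooth f /\
  forall p, exists phi psi, [/\ chart_at p phi, chart_at (f p) psi &
    forall w, exists v, 'd (local_rep phi psi f) (phi p) v = w].

(* Smoothness of a map f defined on a subset of M, which is presented as the
   image of an injection iota : A -> M: near each point, f is the restriction
   of a smooth map on an open subset of M.  This is used for [0,1] in R, for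
   [0,1]^2 in R^2, and for the fibre product of composable arrows, where, as the
   latter is an embedded submanifold, it agrees with smoothness for the
   submanifold structure. *)
Definition local_extension (A : Type) (iota : A -> M) (f : A -> N) (a : A)
    (g : M -> N) : Prop :=
  smooth_at g (iota a) /\
  \forall q \near iota a, forall b, iota b = q -> f b = g q.

Definition smooth_along (A : Type) (iota : A -> M) (f : A -> N) : Prop :=
  forall a, exists g, local_extension iota f a g.

End SmoothMaps.

Record groupoid (Ob Mor : Type) := Groupoid {
  gsrc : Mor -> Ob;
  gtgt : Mor -> Ob;
  gid : Ob -> Mor;
  (* gcomp g f is g \circ f; its value is irrelevant unless gsrc g = gtgt f *)
  gcomp : Mor -> Mor -> Mor;
  ginv : Mor -> Mor;
  gsrc_id : forall x, gsrc (gid x) = x;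
  gtgt_id : forall x, gtgt (gid x) = x;
  gsrc_comp : forall g f, gsrc g = gtgt f -> gsrc (gcomp g f) = gsrc f;
  gtgt_comp : forall g f, gsrc g = gtgt f -> gtgt (gcomp g f) = gtgt g;
  gcompA : forall h g f, gsrc h = gtgt g -> gsrc g = gtgt f ->
    gcomp h (gcomp g f) = gcomp (gcomp h g) f;
  gcomp_idl : forall f, gcomp (gid (gtgt f)) f = f;
  gcomp_idr : forall f, gcomp f (gid (gsrc f)) = f;
  gsrc_inv : forall f, gsrc (ginv f) = gtgt f;
  gtgt_inv : forall f, gtgt (ginv f) = gsrc f;
  gcomp_invl : forall f, gcomp (ginv f) f = gid (gsrc f);
  gcomp_invr : forall f, gcomp f (ginv f) = gid (gtgt f)
}.

Definition composable (Ob Mor : Type) (G : groupoid Ob Mor) : Type :=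
  {p : Mor * Mor | gsrc G p.1 = gtgt G p.2}.

Record lie_groupoid (R : realType) := LieGroupoid {
  lie_ob : manifold R;
  lie_mor : manifold R;
  lie_gpd :> groupoid lie_ob lie_mor;
  lie_src_submersion : submersion (gsrc lie_gpd);
  lie_tgt_submersion : submersion (gtgt lie_gpd);
  lie_id_smooth : smooth (gid lie_gpd);
  lie_inv_smooth : smooth (ginv lie_gpd);
  lie_comp_smooth : @smooth_along _ _ _ (prod_charted lie_mor lie_mor) lie_mor
    (composable lie_gpd) (fun p => sval p)
    (fun p => gcomp lie_gpd (sval p).1 (sval p).2)
}.

Section UnitInterval.
Variable R : realType.

Definition I01 : Type := {r : R | 0 <= r <= 1}.

Lemma I01_0_subproof : 0 <= (0 : R) <= 1. Proof. by rewrite lexx ler01. Qed.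
Lemma I01_1_subproof : 0 <= (1 : R) <= 1. Proof. by rewrite lexx ler01. Qed.

Definition I0 : I01 := exist _ 0 I01_0_subproof.
Definition I1 : I01 := exist _ 1 I01_1_subproof.

(* r as a point of [0,1]; only used for 0 <= r <= 1 *)
Definition toI (r : R) : I01 := insubd I0 r.

Definition path_rev (T : Type) (a : I01 -> T) : I01 -> T :=
  fun r => a (toI (1 - val r)).

(* the concatenation b * a: first a, then b *)
Definition path_cat (T : Type) (b a : I01 -> T) : I01 -> T :=
  fun r => if val r <= 2^-1 then a (toI (2 * val r))
           else b (toI (2 * val r - 1)).

Definition path_const (T : Type) (a : I01 -> T) : Prop := exists x, forall r, a r = x.

Definition sitting (T : Type) (a : I01 -> T) : Prop :=
  exists e : R, [/\ 0 < e < 2^-1,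
    exists x, forall r, val r < e -> a r = x &
    exists y, forall r, 1 - e < val r -> a r = y].

End UnitInterval.

Record spath (R : realType) (E : normedModType R) (M : charted E) := SPath {
  spath_fun :> I01 R -> M;
  spath_smooth : @smooth_along _ _ _ (line R) M (I01 R) val spath_fun;
  spath_sitting : sitting spath_fun
}.

(* Rank of the differential at (r, r') of a local extension of H; on the boundary
   of the square it does not depend on the extension. *)
Definition thin_homotopic (R : realType) (M : manifold R) (a b : I01 R -> M) :
    Prop :=
  let square : charted (R^o * R^o)%type := prod_charted (line R) (line R) in
  let iota : I01 R * I01 R -> square := fun p => (val p.1, val p.2) in
  [/\ a (I0 R) = b (I0 R), a (I1 R) = b (I1 R) &
  exists H : I01 R * I01 R -> M,
  [/\ smooth_along iota H,
      forall p, exists g, local_extension iota H p g /\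
        exists phi psi, [/\ chart_at (iota p) phi, chart_at (H p) psi &
          (\dim (limg (linfun ('d (local_rep phi psi g) (phi (iota p))))) <= 1)%N] &
      exists e : R, 0 < e < 2^-1 /\
      forall r r',
      [/\ val r' < e -> H (r, r') = a (I0 R),
          1 - e < val r' -> H (r, r') = a (I1 R),
          val r < e -> H (r, r') = a r' &
          1 - e < val r -> H (r, r') = b r']]].

Lemma path_const_smooth (R : realType) (E F : normedModType R) (A : Type)
    (L : charted E) (M : charted F) (iota : A -> L) (x : M) :
  smooth_along iota (fun=> x).
Proof.
move=> a; exists (fun=> x); split; last by near=> q.
split; first exact: cst_continuous.
have [phi aphi pphi] := atlas_cover (iota a); have [psi apsi ppsi] := atlas_cover x.
exists phi, psi; split => //; exists setT; first by split => //; exact: openT.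
by move=> k; exact: Ck_cst.
Unshelve. all: by end_near. Qed.

Lemma path_const_sitting (R : realType) (T : Type) (x : T) :
  sitting (fun _ : I01 R => x).
Proof.
exists 4^-1; split; [|by exists x|by exists x].
by rewrite invr_gt0 ltr0n ltf_pV2 ?posrE ?ltr0n // ltr_nat.
Qed.

Definition const_path (R : realType) (E : normedModType R) (M : charted E) (x : M) :
    spath M :=
  SPath (path_const_smooth val x) (path_const_sitting R x).

Section Reversal.
Variables (R : realType) (E : normedModType R) (M : charted E).

Let refl (r : R^o) : R^o := 1 - r.

Let derive_refl (F : normedModType R) (f : R^o -> F) v x :
  'D_v (f \o refl) x = 'D_(- v) f (refl x).
Proof.
suff e : f \o refl \o shift x = (f \o shift (refl x)) \o -%R.
  rewrite /derive; set a := fun h => _; set b := fun h => _.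
  suff -> : a = b by [].
  apply/funext => h; rewrite /a /b; congr (_ *: (_ - _)).
  by move/(congr1 (fun u => u (h *: v))): e => /=; rewrite scalerN.
by apply/funext => h; rewrite /= /refl opprD addrCA addrA addrC addrA.
Qed.

Let refl_cont : continuous refl.
Proof. by move=> x; apply: cvgB; [exact: cvg_cst|exact: cvg_id]. Qed.

Let Ck_refl (F : normedModType R) k (U : set R^o) (f : R^o -> F) :
  Ck k U f -> Ck k (refl @^-1` U) (f \o refl).
Proof.
elim: k f => [|k IH] f /=.
  by move=> fc x Ux; apply: continuous_comp; [exact: refl_cont|exact: fc].
move=> [fd fD]; split=> [x Ux|v].
  by apply: differentiable_comp; [exact: differentiableB|exact: fd].
have -> : (fun x => 'D_v (f \o refl) x) = (fun x => 'D_(- v) f x) \o refl.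
  by apply/funext => x; rewrite derive_refl.
exact: IH.
Qed.

Lemma toI_val (r : R) : 0 <= r <= 1 -> val (toI r) = r.
Proof. by move=> r01; rewrite /toI val_insubd r01. Qed.

Lemma I01_onem (r : I01 R) : 0 <= 1 - val r <= 1.
Proof. by case: r => r /= /andP[r0 r1]; rewrite subr_ge0 r1 gerBl. Qed.

Lemma path_rev_smooth (a : spath M) :
  @smooth_along _ _ _ (line R) M (I01 R) val (path_rev a).
Proof.
move=> r; have [g [[gc [phi [psi [[aphi pphi] cpsi [U [oU Up] sU]]]]] gE]] :=
  spath_smooth a (toI (1 - val r)).
have phiE : phi = id_chart R^o by exact: aphi.
subst phi.
have rE : val (toI (1 - val r)) = refl (val r) by rewrite toI_val // I01_onem.
rewrite rE in gc cpsi Up gE.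
exists (g \o refl); split.
  split.
    by apply: (@continuous_comp R^o R^o M); [exact: refl_cont|exact: gc].
  exists (id_chart R^o), psi; split => //.
  exists (refl @^-1` U); last by move=> k; exact: (Ck_refl (sU k)).
  by split; [exact: (proj1 (continuousP _) refl_cont)|exact: Up].
have gE' := refl_cont gE.
apply: (@filterS R^o (nbhs (val r : R^o)) _ _ _ _ gE') => q /= gq b bq; rewrite /path_rev; apply: gq.
by rewrite toI_val ?I01_onem // -bq.
Qed.

Lemma path_rev_sitting (a : spath M) : sitting (path_rev a).
Proof.
have [e [e01 [x xP] [y yP]]] := spath_sitting a.
exists e; split => //; [exists y|exists x] => r re; rewrite /path_rev.
  by apply: yP; rewrite toI_val ?I01_onem // ltrD2l ltrN2.
by apply: xP; rewrite toI_val ?I01_onem // ltrBlDr -ltrBlDl.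
Qed.

Definition rev_path (a : spath M) : spath M :=
  SPath (path_rev_smooth a) (path_rev_sitting a).

End Reversal.

Section LazyPaths.
Variables (R : realType) (X : lie_groupoid R).

Local Notation X0 := (lie_ob X).
Local Notation X1 := (lie_mor X).
Local Notation s := (gsrc X).
Local Notation t := (gtgt X).

(* The sequence (g_0, a_1, g_1, ..., a_n, g_n) is represented by the pair of g_0
   and the list [:: (a_1, g_1); ...; (a_n, g_n)]. *)
Local Notation lazy_seq := (X1 * seq (spath X0 * X1))%type.

Fixpoint lazy_chain (g : X1) (l : seq (spath X0 * X1)) : Prop :=
  if l is (a, h) :: l' then
    [/\ t g = a (I0 R), s h = a (I1 R) & lazy_chain h l']
  else True.

Record lazy_path := LazyPath {
  lazy_val :> lazy_seq;
  lazy_valP : lazy_chain lazy_val.1 lazy_val.2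
}.

Definition lazy_first (G : lazy_path) : X1 := G.1.
Definition lazy_last (G : lazy_path) : X1 := last G.1 (map snd G.2).

(* The first three constructors act at the beginning of a sequence; move_tail
   lets them act at an arbitrary place. *)
Inductive lazy_move : lazy_seq -> lazy_seq -> Prop :=
| move_const (g h : X1) (a : spath X0) l :
    path_const a -> lazy_move (g, (a, h) :: l) (gcomp X h g, l)
| move_id (g k : X1) (a b c : spath X0) (x : X0) l :
    c = path_cat b a :> (I01 R -> X0) ->
    lazy_move (g, (a, gid X x) :: (b, k) :: l) (g, (c, k) :: l)
| move_transport (g h : X1) (a b : spath X0) (z : spath X1) l :
    s \o z = a :> (I01 R -> X0) -> b = t \o z :> (I01 R -> X0) ->
    lazy_move (g, (a, h) :: l)
      (gcomp X (z (I0 R)) g, (b, gcomp X h (ginv X (z (I1 R)))) :: l)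
| move_tail (g h h' : X1) (a : spath X0) l l' :
    lazy_move (h, l) (h', l') ->
    lazy_move (g, (a, h) :: l) (g, (a, h') :: l').

(* z is the path z_{i-1}; the lists are the parts of the two lazy paths after
   g_{i-1} and g'_{i-1}. *)
Fixpoint thin_deformation_from (z : spath X1) (l l' : seq (spath X0 * X1)) :
    Prop :=
  match l, l' with
  | [::], [::] => path_const (t \o z)
  | (a, g) :: l, (a', g') :: l' => exists z' : spath X1,
      [/\ z' (I0 R) = g, z' (I1 R) = g',
          thin_homotopic a (path_cat (path_cat (path_rev (s \o z')) a') (t \o z)) &
          thin_deformation_from z' l l']
  | _, _ => False
  end.

Definition thin_deformation (G G' : lazy_path) : Prop := exists z : spath X1,
  [/\ z (I0 R) = G.1, z (I1 R) = G'.1, path_const (s \o z) &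
      thin_deformation_from z G.2 G'.2].

Definition lazy_step (G G' : lazy_path) : Prop :=
  lazy_move G G' \/ thin_deformation G G'.

Definition lazy_thin_homotopic : lazy_path -> lazy_path -> Prop :=
  clos_refl_sym_trans lazy_path lazy_step.

Definition lazy_thin_rel (G G' : {classic lazy_path}) : bool :=
  `[< lazy_thin_homotopic G G' >].

Lemma lazy_thin_refl : reflexive lazy_thin_rel.
Proof. by move=> G; apply/asboolP; exact: rst_refl. Qed.

Lemma lazy_thin_sym : symmetric lazy_thin_rel.
Proof. by move=> G G'; apply/asboolP/asboolP => ?; exact: rst_sym. Qed.

Lemma lazy_thin_trans : transitive lazy_thin_rel.
Proof. by move=> G G' G'' /asboolP h /asboolP h'; apply/asboolP; exact: rst_trans h h'. Qed.

Canonical lazy_thin_equiv :=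
  EquivRel lazy_thin_rel lazy_thin_refl lazy_thin_sym lazy_thin_trans.

Definition thin_mor : Type := {eq_quot lazy_thin_equiv}.

Definition thin_class (G : lazy_path) : thin_mor :=
  \pi_({eq_quot lazy_thin_equiv}) (G : {classic lazy_path}).

(* (g, l) followed by (g', l'): the last arrow h of (g, l) is replaced by
   the composite of h with the first arrow of G' *)
Fixpoint lazy_cat (g : X1) (l : seq (spath X0 * X1)) (G' : lazy_seq) : lazy_seq :=
  if l is (a, h) :: l' then
    let K := lazy_cat h l' G' in (g, (a, K.1) :: K.2)
  else (gcomp X G'.1 g, G'.2).

Lemma lazy_cat_src g l G' :
  s G'.1 = t (last g (map snd l)) -> s (lazy_cat g l G').1 = s g.
Proof. by case: l => [|[a h] l] //= e; exact: gsrc_comp. Qed.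

Lemma lazy_cat_chain g l (G' : lazy_seq) :
  lazy_chain g l -> lazy_chain G'.1 G'.2 ->
  s G'.1 = t (last g (map snd l)) ->
  lazy_chain (lazy_cat g l G').1 (lazy_cat g l G').2.
Proof.
elim: l g => [|[a h] l IH] g /=.
  by case: G' => g' [|[b k] l'] //= _ [? ? ?] e; split => //; rewrite gtgt_comp.
move=> [ga ha hl] G'c e; split => //; last exact: IH.
by rewrite lazy_cat_src.
Qed.

Definition lazy_comp (G' G : lazy_path) (e : s (lazy_first G') = t (lazy_last G)) :
    lazy_path :=
  @LazyPath (lazy_cat G.1 G.2 G') (lazy_cat_chain (lazy_valP G) (lazy_valP G') e).

Lemma lazy_unit_chain (x : X0) : lazy_chain (gid X x) [:: (const_path x, gid X x)].
Proof. by split => //=; rewrite ?gtgt_id ?gsrc_id. Qed.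

Definition lazy_unit (x : X0) : lazy_path :=
  @LazyPath (gid X x, [:: (const_path x, gid X x)]) (lazy_unit_chain x).

(* acc is the list part of the inverse of the prefix that ends with g *)
Fixpoint lazy_rev (g : X1) (l acc : seq (spath X0 * X1)) : lazy_seq :=
  if l is (a, h) :: l' then lazy_rev h l' ((rev_path a, ginv X g) :: acc)
  else (ginv X g, acc).

Lemma lazy_rev_chain g l acc :
  lazy_chain g l -> lazy_chain (ginv X g) acc ->
  lazy_chain (lazy_rev g l acc).1 (lazy_rev g l acc).2.
Proof.
elim: l g acc => [|[a h] l IH] g acc //= [ga ha hl] gacc.
have onem0 : toI (1 - 0 : R) = I1 R by apply: val_inj; rewrite toI_val subr0 ?lexx ?ler01.
have onem1 : toI (1 - 1 : R) = I0 R by apply: val_inj; rewrite toI_val subrr ?lexx ?ler01.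
apply: IH => //=; split => //; rewrite /path_rev/=.
  by rewrite gtgt_inv ha onem0.
by rewrite gsrc_inv ga onem1.
Qed.

Definition lazy_inv (G : lazy_path) : lazy_path :=
  @LazyPath (lazy_rev G.1 G.2 [::])
    (@lazy_rev_chain G.1 G.2 [::] (lazy_valP G) I).

End LazyPaths.

(* Main.v *)
Require Import Defs.
From HB Require Import structures.
From Stdlib Require Import Relation_Operators.
From mathcomp Require Import all_boot all_order all_algebra.
From mathcomp Require Import boolp classical_sets functions reals.
From mathcomp Require Import topology normedtype landau derive sequences exp realfun.
From mathcomp Require Import ring lra.

(** Concatenation of lazy paths is strictly associative, and inserting a constant path
    between [1_x] and an arrow is an elementary move, so associativity and the
    unit laws are immediate. What has to be proved is that concatenation respects
    thin homotopy, and that a lazy path followed by its reverse contracts.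

    Compatibility with moves is algebra ([lazy_move_catl], [lazy_move_catr]). For
    a thin deformation of one factor, a constant path is first inserted at the
    junction, so that the arrows of the two factors are not composed; the
    deformation then runs next to the constant deformation of the other factor
    ([lazy_comp_deformation]). The constant deformation exists because a path
    padded with constants is thin homotopic to itself ([thin_homotopic_pad]).

    For the inverse law, the arrows in the middle of the concatenation cancel, the
    resulting identity is removed, a path meets its reverse, and this loop is thin
    homotopic to a constant ([thin_homotopic_cancel]); removing the constant path
    lets the induction continue ([lazy_rev_cancel]). In a category in which every
    arrow has a left inverse these are two-sided and unique
    ([groupoid_of_left_inverses]), so the reverse induces the inverse on classes.

    Both thin homotopies reparametrize a single path [a]: they are of the form [a
    \o phi] with [phi] a smooth function from the plane to the line, hence of rank
    at most one ([thin_homotopic_reparam]). The functions [phi] are built from a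
    smooth step function, itself composed of affine maps and copies of [exp(-1/x)]
    ([smooth_step]). *)

Set Implicit Arguments.
Unset Strict Implicit.
Unset Printing Implicit Defensive.

Import Order.TTheory GRing.Theory Num.Theory.
Import numFieldNormedType.Exports.

Local Open Scope ring_scope.
Local Open Scope classical_set_scope.

(** * Calculus of C^k maps *)

Section CkCalculus.
Variable R : realType.
Implicit Types E F : normedModType R.

(** The differential is defined by a choice among linear approximations, so its
    locality has to be derived from the uniqueness of such an approximation. *)
Lemma near_eq_diff E F (f g : E -> F) x :
  (\forall y \near x, f y = g y) -> differentiable f x ->
  differentiable g x /\ 'd g x = 'd f x :> (E -> F).
Proof.
move=> fg df; have /diff_locallyP[dfc /eqaddoP dfx] := df.
have gx : g \o shift x = cst (g x) + 'd f x +o_ 0 id.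
  apply/eqaddoP => e e0; have := dfx e e0.
  have fg0 := nbhs_singleton fg.
  move=> dfe; move: fg; rewrite (near_shift 0 x) subr0.
  move: dfe; apply: filterS2 => y /= dfe fgy.
  by move: dfe; rewrite !fctE /= fgy fg0.
have dg : 'd g x = 'd f x :> (E -> F) by exact: diff_unique.
split; last exact: dg.
by apply/diff_locallyP; rewrite dg; split; [exact: dfc|exact: gx].
Qed.

Lemma Ck_sub E F k (U V : set E) (f : E -> F) : U `<=` V -> Ck k V f -> Ck k U f.
Proof.
move=> UV; elim: k f => [|k IH] f /=; first by move=> fV x /UV/fV.
by move=> [fd fD]; split=> [x /UV/fd|v] //; exact: IH.
Qed.

(** Formulas for directional derivatives hold only on the open set [U] where the map
    is known to be regular; this lemma makes them usable in inductions on [k]. *)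
Lemma Ck_ext E F k (U : set E) (f g : E -> F) : open U ->
  (forall x, U x -> f x = g x) -> Ck k U f -> Ck k U g.
Proof.
move=> oU; elim: k f g => [|k IH] f g fg /=.
  move=> fc x Ux; have nfg : \forall y \near x, f y = g y.
    by apply: filterS (open_nbhs_nbhs (conj oU Ux)) => y /fg.
  move: (fc x Ux); rewrite /prop_for /continuous_at (fg x Ux).
  by apply: cvg_trans; exact: near_eq_cvg.
move=> [fd fD].
have nfg x : U x -> \forall y \near x, f y = g y.
  by move=> Ux; apply: filterS (open_nbhs_nbhs (conj oU Ux)) => y /fg.
split=> [x Ux|v]; first by have [] := near_eq_diff (nfg x Ux) (fd x Ux).
by apply: IH (fD v) => x Ux; exact: near_eq_derive (nfg x Ux).
Qed.

Lemma Ck_weaken E F k (U : set E) (f : E -> F) : Ck k.+1 U f -> Ck k U f.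
Proof.
elim: k f => [|k IH] f [fd fD].
  by move=> x Ux; apply: differentiable_continuous; exact: fd.
by split => // v; apply: IH; exact: fD.
Qed.

Lemma CkD E F k (U : set E) (f g : E -> F) : open U ->
  Ck k U f -> Ck k U g -> Ck k U (fun x => f x + g x).
Proof.
move=> oU; elim: k f g => [|k IH] f g.
  by move=> fc gc x Ux; apply: cvgD; [exact: fc|exact: gc].
move=> [fd fD] [gd gD]; split=> [x Ux|v].
  by apply: differentiableD; [exact: fd|exact: gd].
apply: (Ck_ext oU _ (IH _ _ (fD v) (gD v))) => x Ux /=.
by rewrite [RHS]deriveD //; apply: diff_derivable; [exact: fd|exact: gd].
Qed.

(** Scalar multiplication as a named two-argument function, so that it can carry the
    bilinear structure from which its differential is computed. *)
Definition scale_by (W : normedModType R) (a : R^o) (w : W) : W := a *: w.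

Lemma scale_bilinear (W : normedModType R) :
  bilinear_for (GRing.Scale.Law.clone _ _ *:%R _)
    (GRing.Scale.Law.clone _ _ *:%R _) (@scale_by W).
Proof.
rewrite /scale_by; split=> [w|a] b x y /=; first by rewrite scalerDl -scalerA.
by rewrite scalerDr !scalerA mulrC.
Qed.

HB.instance Definition _ (W : normedModType R) :=
  bilinear_isBilinear.Build R R^o W W _ _ (@scale_by W)
  (@scale_bilinear W).

Lemma diff_scale E F (u : E -> R^o) (w : E -> F) x :
  differentiable u x -> differentiable w x ->
  differentiable (fun y => u y *: w y) x /\
  forall v, 'd (fun y => u y *: w y) x v = 'd u x v *: w x + u x *: 'd w x v.
Proof.
move=> du dw; set f := @scale_by F.
have fc : continuous (fun p : R^o * F => f p.1 p.2).
  by move=> p; apply: cvgZ; [exact: cvg_fst|exact: cvg_snd].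
have dp := differentiable_pair du dw.
have db : differentiable (fun p : R^o * F => f p.1 p.2) (u x, w x).
  exact: (@differentiable_bilin _ _ _ _ f).
have E1 : (fun y => u y *: w y) =
    (fun p : R^o * F => f p.1 p.2) \o (fun y => (u y, w y)) by [].
rewrite E1; split; first exact: differentiable_comp.
move=> v; rewrite diff_comp //= diff_pair //=.
by rewrite (@diff_bilin _ _ _ _ f) //= addrC.
Qed.

Lemma Ck_scale E F k (U : set E) (u : E -> R^o) (w : E -> F) : open U ->
  Ck k U u -> Ck k U w -> Ck k U (fun x => u x *: w x).
Proof.
move=> oU; elim: k u w => [|k IH] u w.
  by move=> uc wc x Ux; apply: cvgZ; [exact: uc|exact: wc].
move=> Su Sw; have [ud uD] := Su; have [wd wD] := Sw.
split=> [x Ux|v]; first by have [] := diff_scale (ud x Ux) (wd x Ux).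
have := CkD oU (IH _ _ (uD v) (Ck_weaken Sw)) (IH _ _ (Ck_weaken Su) (wD v)).
apply: Ck_ext => // x Ux; have [d dE] := diff_scale (ud x Ux) (wd x Ux).
by rewrite [RHS]deriveE // dE !deriveE //; [exact: wd|exact: ud].
Qed.

(** The middle space is the real line, as every map composed below factors through the
    parameter of a single path.  There the chain rule reads
    [D_v (g \o f) = D_v f *: (D_1 g \o f)], so that the induction closes with the
    product rule. *)
Lemma Ck_comp E F k (V : set R^o) (f : E -> R^o) (g : R^o -> F) : open V ->
  Ck k setT f -> Ck k V g -> Ck k (f @^-1` V) (g \o f).
Proof.
move=> oV; elim: k f g => [|k IH] f g.
  by move=> fc gc x Vx; apply: continuous_comp; [exact: fc|exact: gc].
move=> Sf [gd gD]; have [fd fD] := Sf.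
have fc : continuous f by move=> x; apply: differentiable_continuous; exact: fd.
have oU : open (f @^-1` V) by exact: (proj1 (continuousP _) fc).
split=> [x Vx|v].
  by apply: differentiable_comp; [exact: fd|exact: gd].
have SD : Ck k (f @^-1` V) (fun x => 'D_v f x) by apply: Ck_sub (fD v).
have := Ck_scale oU SD (IH _ _ (Ck_weaken Sf) (gD 1)).
apply: Ck_ext => // x Vx /=.
rewrite [RHS]deriveE; last by apply: differentiable_comp; [exact: fd|exact: gd].
rewrite diff_comp; [|exact: fd|exact: gd].
rewrite /= !deriveE; [|exact: gd|exact: fd].
by rewrite -linearZ /= [_ *: 1]mulr1.
Qed.

Lemma Ck_linear E F k (U : set E) (f : {linear E -> F}) :
  continuous f -> Ck k U f.
Proof.
move=> fc; case: k => [x _|k]; first exact: fc.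
split=> [x _|v]; first exact: linear_differentiable.
have -> : (fun x => 'D_v f x) = (fun=> f v).
  apply/funext => x; rewrite deriveE ?diff_lin //.
  exact: linear_differentiable.
exact: Ck_cst.
Qed.

End CkCalculus.

(** * Smooth step functions *)

Section SmoothStep.
Variable R : realType.

(** The functions [x^-n exp(-1/x)], extended by [0] to [x <= 0]. Indexing by [n] makes
    the family closed under differentiation, up to linear combinations. *)
Definition flat (n : nat) (x : R) : R :=
  if 0 < x then x^-1 ^+ n * expR (- x^-1) else 0.

(** The exponential [exp(1/x)] dominates the monomial [(1/x)^(n+2) / (n+2)!]. The
    bound is quadratic, so the derivative at [0] vanishes. *)
Lemma flat_le n (x : R) : `|flat n x| <= n.+2`!%:R * x ^+ 2.
Proof.
rewrite /flat; case: ltP => [x0|_]; last by rewrite normr0 mulr_ge0// sqr_ge0.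
have y0 : 0 < x^-1 by rewrite invr_gt0.
rewrite ger0_norm; last by rewrite mulr_ge0 ?expR_ge0// exprn_ge0// ltW.
rewrite expRN ler_pdivrMr ?expR_gt0//.
have f0 : 0 < (n.+2`!%:R : R) by rewrite ltr0n fact_gt0.
have /(le_trans _) H := @expR_ge1Dxn R x^-1 n.+1 (ltW y0).
have : x^-1 ^+ n.+2 / n.+2`!%:R <= expR x^-1 by apply: H; rewrite lerDr.
rewrite ler_pdivrMr// => h.
have -> : x^-1 ^+ n = x^-1 ^+ n.+2 * x ^+ 2.
  by rewrite -addn2 exprD -mulrA -exprMn mulVf ?gt_eqF// expr1n mulr1.
by rewrite [leRHS]mulrAC ler_wpM2r ?sqr_ge0// mulrC.
Qed.

Lemma flat_derive0 n : is_derive (0 : R) 1 (flat n) 0.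
Proof.
suff c : (fun h : R => h^-1 *: ((flat n \o shift 0) (h *: 1) - flat n 0)) @ 0^'
    --> (0 : R).
  by split; [apply/cvg_ex; exists 0|exact/cvg_lim].
apply/cvgr0Pnorm_le => /= e e0.
have f0 : 0 < (n.+2`!%:R : R) by rewrite ltr0n fact_gt0.
near=> h; have h0 : h != 0 by near: h; exact: nbhs_dnbhs_neq.
rewrite /= addr0 [h *: _]mulr1 [flat n 0]/flat ltxx subr0 normrM normfV.
rewrite ler_pdivrMl ?normr_gt0//; apply: le_trans (flat_le n h) _.
rewrite -real_normK ?num_real// expr2 mulrCA ler_wpM2l//.
rewrite -ler_pdivlMl//; near: h; apply: dnbhs0_le.
by rewrite mulr_gt0// invr_gt0.
Unshelve. all: by end_near. Qed.

(** Away from [0] the function agrees locally with a smooth formula, and at [0] the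
    quadratic bound applies. *)
Lemma flat_derive n (x : R) :
  is_derive x 1 (flat n) (flat n.+2 x - n%:R * flat n.+1 x).
Proof.
have [x0|x0|<-] := ltgtP 0 x; last 1 first.
- apply: is_derive_eq (flat_derive0 n) _.
  by rewrite /flat ltxx mulr0 subr0.
- have D : is_derive x 1 (fun y : R => y^-1 ^+ n * expR (- y^-1))
      (flat n.+2 x - n%:R * flat n.+1 x).
    have xn : x != 0 by rewrite gt_eqF.
    have DV : is_derive x 1 (fun y : R => y^-1) (- x ^- 2).
      apply: is_derive_eq (@is_deriveV _ id x 1 1 xn (is_derive_id x 1)) _.
      by rewrite scaler1.
    have DE : is_derive x 1 (fun y : R => expR (- y^-1)) (expR (- x^-1) * x ^- 2).
      apply: is_derive_eq (is_derive1_comp (is_derive_expR _) (is_deriveN DV)) _.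
      by rewrite opprK.
    have DX : is_derive x 1 (fun y : R => y^-1 ^+ n) (- (n%:R * x^-1 ^+ n.+1)).
      have <- : (fun y : R => y^-1) ^+ n = (fun y => y^-1 ^+ n).
        by apply/funext => y; rewrite exprfctE.
      apply: is_derive_eq (@is_deriveX _ _ (fun y : R => y^-1) n x 1 _ DV) _.
      case: n => [|n]; first by rewrite !mul0r scale0r oppr0.
      rewrite /GRing.scale /= mulrN -exprVn -mulrA -exprD; congr (- (_ * _ ^+ _)).
      by rewrite addn2.
    apply: is_derive_eq (@is_deriveM _ _ _ _ x 1 _ _ DX DE) _.
    rewrite /flat x0 /GRing.scale /= -exprVn -[in RHS]addn2 exprD.
    by ring.
  apply: near_eq_is_derive D.
  near=> y; rewrite /flat ifT//; near: y; exact: lt_nbhsr.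
- rewrite {2 3}/flat !ltNge (ltW x0) /= mulr0 subr0.
  apply: near_eq_is_derive (is_derive_cst 0 x 1).
  near=> y; rewrite /flat ltNge ifF //; apply/negbTE; rewrite negbK ltW//.
  by near: y; exact: lt_nbhsl.
Unshelve. all: by end_near. Qed.

Lemma flat_Ck n k (U : set R^o) : open U -> Ck k U (flat n : R^o -> R^o).
Proof.
move=> oU; elim: k n => [|k IH] n.
  move=> x _; apply: differentiable_continuous; apply/derivable1_diffP.
  by have [] := flat_derive n x.
have fd x : differentiable (flat n : R^o -> R^o) x.
  by apply/derivable1_diffP; have [] := flat_derive n x.
split=> [x _|v]; first exact: fd.
have := @Ck_scale _ _ R^o _ _ _ _ oU (Ck_cst _ _ v)
  (CkD oU (IH n.+2) (Ck_scale oU (Ck_cst _ _ (- n%:R : R^o)) (IH n.+1))).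
apply: Ck_ext => // x _.
rewrite deriveE // -[in RHS](mulr1 v) -[v * 1]/(v *: (1:R^o)) linearZ /=.
rewrite -deriveE //; have [_ ->] := flat_derive n x.
by rewrite -mulNr.
Qed.

Lemma flat0_gt0 (x : R) : 0 < x -> 0 < flat 0 x.
Proof. by move=> x0; rewrite /flat x0 expr0 mul1r expR_gt0. Qed.

Lemma flat0_ge0 (x : R) : 0 <= flat 0 x.
Proof. by rewrite /flat; case: ltP => // _; rewrite mulr_ge0 ?expR_ge0. Qed.

Lemma flat0_eq0 (x : R) : x <= 0 -> flat 0 x = 0.
Proof. by rewrite /flat ltNge => ->. Qed.

Lemma flat0_homo : {homo (flat 0 : R -> R) : x y / x <= y}.
Proof.
move=> x y xy; have [x0|x0] := ltP 0 x; last by rewrite flat0_eq0// flat0_ge0.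
have y0 := lt_le_trans x0 xy.
by rewrite /flat x0 y0 !expr0 !mul1r ler_expR lerN2 lef_pV2.
Qed.

Lemma Ck_affine k (p q : R^o) : Ck k setT (fun x : R^o => p * x + q).
Proof.
apply: CkD; [exact: openT| |exact: Ck_cst].
apply: (@Ck_scale _ _ _ _ _ (fun=> p) idfun openT); first exact: Ck_cst.
by apply: (@Ck_linear _ _ _ _ _ idfun) => x; exact: cvg_id.
Qed.

(** With [f] the flat function [exp(-1/x)] and [c := f (1/2)], the map [y |-> f (c - f
    (1 - y)) / f c] is [0] for [y <= 1/2], since there [f (1 - y) >= c], and [1]
    for [y >= 1], since there [f (1 - y) = 0]. Precomposing with an affine map
    moves the two thresholds to [a] and [b]. The denominator is constant, so
    smoothness reduces to that of a composite. *)
Lemma smooth_step (a b : R) : a < b -> exists S : R^o -> R^o,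
  [/\ smooth_on setT S, forall x, 0 <= S x <= 1,
      forall x, x <= a -> S x = 0 & forall x, b <= x -> S x = 1].
Proof.
move=> ab; have d0 : 0 < 2 * (b - a) by rewrite mulr_gt0// subr_gt0.
have h0 : 0 < 2^-1 :> R by rewrite invr_gt0.
pose c : R := flat 0 2^-1; have c0 : 0 < c by exact: flat0_gt0.
pose N := flat 0 c; have N0 : 0 < N by exact: flat0_gt0.
(* the affine map [1 - y], where [y] sends [a] to 1/2 and [b] to 1 *)
pose u (x : R^o) : R^o := - (2 * (b - a))^-1 * x + (1 - 2^-1 + a / (2 * (b - a))).
have uE x : u x = 2^-1 - (x - a) / (2 * (b - a)).
  rewrite /u; field; by rewrite subr_eq0 gt_eqF.
pose w (y : R^o) : R^o := (-1) * y + c.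
pose S : R^o -> R^o := fun x => N^-1 *: flat 0 (w (flat 0 (u x))).
have SE x : S x = flat 0 (w (flat 0 (u x))) / N by exact: mulrC.
exists S; split.
- move=> k; apply: (@Ck_scale _ _ _ _ _ (fun=> N^-1) _ openT); first exact: Ck_cst.
  have Su := @Ck_comp _ _ _ k _ u (flat 0) openT (Ck_affine k _ _) (flat_Ck 0 k openT).
  have Sw := @Ck_comp _ _ _ k _ _ w openT Su (Ck_affine k (-1) c).
  exact: (@Ck_comp _ _ _ k _ _ (flat 0) openT Sw (flat_Ck 0 k openT)).
- move=> x; rewrite SE; apply/andP; split.
    by rewrite mulr_ge0 ?flat0_ge0// invr_ge0 ltW.
  rewrite ler_pdivrMr// mul1r flat0_homo// /w mulN1r addrC gerBl.
  exact: flat0_ge0.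
- move=> x xa; rewrite SE flat0_eq0 ?mul0r// /w mulN1r addrC subr_le0.
  by rewrite flat0_homo// uE lerDl -mulNr opprB divr_ge0 ?subr_ge0// ltW.
- move=> x bx; rewrite SE /w (flat0_eq0 (x := u x)); last first.
    rewrite uE subr_le0 ler_pdivlMr//; lra.
  by rewrite mulr0 add0r [LHS]mulfV// gt_eqF.
Qed.

End SmoothStep.

(** * Extending a path with sitting instants to the whole line *)

Section PathExtension.
Variables (R : realType) (F : normedModType R) (M : charted F).

(** On the line the identity is the only chart, so the two local representatives can
    be compared in the same charts. *)
Lemma near_line_smooth_at (f g : line R -> M) (p : line R) :
  smooth_at f p -> (\forall q \near p, f q = g q) -> smooth_at g p.
Proof.
move=> [fc [phi [psi [[aphi pphi] cpsi [U oU sU]]]]] fg.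
have fgp := nbhs_singleton fg.
have phiE : phi = id_chart R^o by exact: aphi.
subst phi; split.
  move: fc; rewrite /prop_for /continuous_at -fgp.
  by apply: cvg_trans; exact: near_eq_cvg.
exists (id_chart R^o), psi; split => //; first by rewrite -fgp.
have [V oV Vfg] : exists2 V : set R^o, open_nbhs p V & forall q, V q -> f q = g q.
  exists ([set q : R^o | f q = g q]^°); last exact: interior_subset.
  by split; [exact: open_interior|exact: fg].
exists (U `&` V); first exact: open_nbhsI.
move=> k; apply: (@Ck_ext R R^o F k (U `&` V)
  (@local_rep R _ _ (line R) M (id_chart R^o) psi f)).
- by apply: openI; [case: oU|case: oV].
- by move=> x [_ /Vfg fgx]; rewrite /local_rep /= fgx.
- by apply: Ck_sub (sU k) => x [].
Qed.

Lemma smooth_at_cst (E : normedModType R) (L : charted E) (x : M) (p : L) :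
  smooth_at (fun=> x : M) p.
Proof.
split; first exact: cst_continuous.
have [phi aphi pphi] := atlas_cover p; have [psi apsi ppsi] := atlas_cover x.
exists phi, psi; split => //; exists setT; first by split => //; exact: openT.
by move=> k; exact: Ck_cst.
Qed.

(** Since the line has a single chart, smooth maps on it can be reparametrized
    without any change of charts. *)
Lemma smooth_at_comp_line (E : normedModType R) (L : charted E) (g : line R -> M)
    (phi : L -> R^o) (p : L) (c : chart E L) :
  chart_at p c -> {for p, continuous phi} -> smooth_on setT (phi \o chart_inv c) ->
  smooth_at g (phi p) ->
  smooth_at (g \o phi) p.
Proof.
move=> [ac cp] phic sphi [gc [d [psi [[ad _] cpsi [U [oU Up] sU]]]]].
have dE : d = id_chart R^o by exact: ad.
subst d.
split; first exact: continuous_comp.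
have phiE : (phi \o chart_inv c) (c p) = phi p by rewrite /= chart_mapK.
exists c, psi; split => //; exists ((phi \o chart_inv c) @^-1` U).
  split; last by rewrite /preimage /mkset phiE.
  have cc : continuous (phi \o chart_inv c).
    by move=> x; exact: (sphi 0%N x I).
  exact: (proj1 (continuousP _) cc).
move=> k; exact: (Ck_comp oU (sphi k) (sU k)).
Qed.

Definition clamp (x : R) : I01 R := toI (Num.max 0 (Num.min 1 x)).

Lemma clamp_val (x : R) : val (clamp x) = Num.max 0 (Num.min 1 x).
Proof. by rewrite toI_val // le_max lexx /= ge_max ler01 ge_min lexx. Qed.

(** The extension of a path to the line, constant outside [0,1].  For a path with
    sitting instants it is smooth, which replaces the local extensions at the end
    points by one global map. *)
Definition on_line (a : I01 R -> M) (x : line R) : M := a (clamp x).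

Lemma on_line_val (a : I01 R -> M) (r : I01 R) : on_line a (val r) = a r.
Proof.
congr a; apply: val_inj; rewrite clamp_val; case: r => r /= /andP[r0 r1].
by rewrite min_r// max_r.
Qed.

Lemma on_line_toI (a : I01 R -> M) (x : R) : 0 <= x <= 1 -> a (toI x) = on_line a x.
Proof. by move=> x01; rewrite -{2}(toI_val x01) on_line_val. Qed.

Lemma on_line_sitting (a : spath M) : exists e : R, [/\ 0 < e < 2^-1,
  forall x : R, x < e -> on_line a x = a (I0 R) &
  forall x : R, 1 - e < x -> on_line a x = a (I1 R)].
Proof.
have [e [e01 [x0 x0P] [x1 x1P]]] := spath_sitting a.
have /andP[e0 e2] := e01; exists e; split => // x xe.
  rewrite [RHS]x0P // [LHS]x0P // clamp_val gt_max e0 gt_min xe orbT//.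
rewrite [RHS]x1P /=; last by rewrite gtrBl.
by rewrite [LHS]x1P // clamp_val lt_max lt_min xe andbT gtrBl e0 orbT.
Qed.

(** Near [0], near [1] and outside the interval the extension is constant; at the
    interior points, a local extension of the path agrees with it nearby. *)
Lemma on_line_smooth (a : spath M) : smooth (on_line a).
Proof.
move=> p; have [e [/andP[e0 e2] a0 a1]] := on_line_sitting a.
have [pe|ep] := ltP p e.
  apply: near_line_smooth_at (@smooth_at_cst _ (line R) (a (I0 R)) p) _.
  near=> q; rewrite a0//; near: q; exact: lt_nbhsl.
have [pe|pe] := ltP (1 - e) p.
  apply: near_line_smooth_at (@smooth_at_cst _ (line R) (a (I1 R)) p) _.
  near=> q; rewrite a1//; near: q; exact: lt_nbhsr.
have p0 : 0 < p by lra.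
have p1 : p < 1 by lra.
have p01' : 0 <= p <= 1 by apply/andP; split; lra.
have [g [sg ag]] := spath_smooth a (toI p).
move: sg ag; rewrite toI_val // => sg ag.
apply: near_line_smooth_at sg _; move: ag; apply: filter_app; near=> q => ag.
have q01 : 0 <= q <= 1.
  by apply/andP; split; apply: ltW; near: q; [exact: lt_nbhsr|exact: lt_nbhsl].
rewrite -(on_line_toI a q01); apply/esym.
by apply: ag; rewrite toI_val.
Unshelve. all: by end_near. Qed.

End PathExtension.

(** * Concatenation of paths *)

Section Concatenation.
Variables (R : realType) (F : normedModType R) (M : charted F).

Lemma path_cat_on_line (a b : I01 R -> M) (r : I01 R) :
  path_cat b a r = if val r <= 2^-1 then on_line a (2 * val r)
                   else on_line b (2 * val r - 1).
Proof.
rewrite /path_cat; case: r => r /= /andP[r0 r1].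
by case: leP => r2; rewrite on_line_toI//; apply/andP; split; lra.
Qed.

(** Up to the middle the concatenation extends to [on_line a (2 x)]; this still holds
    slightly beyond the middle, because there both paths rest at their common
    end point.  After the middle it is [on_line b (2 x - 1)]. *)
Lemma path_cat_smooth (a b : spath M) : a (I1 R) = b (I0 R) ->
  @smooth_along _ _ _ (line R) M (I01 R) val (path_cat b a).
Proof.
move=> ab r.
have [ea [/andP[ea0 _] _ a1]] := on_line_sitting a.
have [eb [/andP[eb0 _] b0 _]] := on_line_sitting b.
have aff (p q : R^o) (g : line R -> M) : smooth g ->
    smooth_at (g \o (fun x : line R => p * x + q : R^o)) (val r : line R).
  move=> sg; apply: (@smooth_at_comp_line R F M R^o (line R) g (fun x => p * x + q) (val r)
    (id_chart R^o)) => //.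
  - by apply: (Ck_affine 0 p q).
  - by move=> k; exact: (Ck_affine k p q).
have [r2|r2] := leP (val r) 2^-1.
  exists (on_line a \o (fun x : line R => 2 * x + 0 : R^o)).
  split; first exact/aff/on_line_smooth.
  have rb : val r < 2^-1 + eb / 2 by lra.
  near=> q => s sq; rewrite path_cat_on_line sq /= addr0.
  case: leP => // q2; rewrite b0; last first.
    have : q < 2^-1 + eb / 2 by near: q; exact: lt_nbhsl.
    lra.
  by rewrite -ab a1//; lra.
exists (on_line b \o (fun x : line R => 2 * x + (- 1) : R^o)).
split; first exact/aff/on_line_smooth.
near=> q => s sq; rewrite path_cat_on_line sq /= ifF//; apply/negbTE.
by rewrite -ltNge; near: q; exact: lt_nbhsr.
Unshelve. all: by end_near. Qed.

Lemma path_cat_sitting (a b : spath M) : sitting (path_cat b a).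
Proof.
have [ea [/andP[ea0 ea1] a0 _]] := on_line_sitting a.
have [eb [/andP[eb0 eb1] _ b1]] := on_line_sitting b.
exists (Num.min ea eb / 2); split.
- have : 0 < Num.min ea eb by rewrite lt_min ea0.
  have : Num.min ea eb <= ea by rewrite ge_min lexx.
  by move=> h h'; apply/andP; split; lra.
- exists (a (I0 R)) => r re; rewrite path_cat_on_line.
  have h : Num.min ea eb <= ea by rewrite ge_min lexx.
  by rewrite ifT ?a0//; lra.
- exists (b (I1 R)) => r re; rewrite path_cat_on_line.
  have h : Num.min ea eb <= eb by rewrite ge_min lexx orbT.
  rewrite ifF; first by rewrite b1//; lra.
  by apply/negbTE; rewrite -ltNge; lra.
Qed.

Definition concat_path (a b : spath M) (ab : a (I1 R) = b (I0 R)) : spath M :=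
  SPath (path_cat_smooth ab) (path_cat_sitting a b).

End Concatenation.

(** * Thin homotopies obtained by reparametrization *)

Section ThinReparametrization.
Variables (R : realType) (M : manifold R).

Local Notation square := (prod_charted (line R) (line R)).
Local Notation sqchart := (prod_chart (id_chart R^o) (id_chart R^o)).

(** The image of the differential is spanned by the derivative of [g]. *)
Lemma rank_through_line (n : nat) (f : R^o * R^o -> R^o) (g : R^o -> 'rV[R]_n) x :
  differentiable f x -> differentiable g (f x) ->
  (\dim (limg (linfun ('d (g \o f) x))) <= 1)%N.
Proof.
move=> df dg.
suff /dimvS/leq_trans : (limg (linfun ('d (g \o f) x)) <= <['d g (f x) 1]>)%VS.
  by apply; rewrite dim_vline; case: (_ != 0).
apply/subvP => _ /memv_imgP[v _ ->]; rewrite lfunE /= diff_comp//=.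
rewrite -['d f x v]mulr1 -[_ * 1]/(_ *: (1 : R^o)) linearZ /=.
by rewrite memvZ// memv_line.
Qed.

(** All thin homotopies of this file have the form [H (r, r') = a (phi (r, r'))] for
    one path [a] and a smooth real function [phi] on the plane: such an [H] is
    smooth, and it has rank at most one as it factors through the line. *)
Lemma thin_homotopic_reparam (a : spath M) (b c : I01 R -> M)
    (phi : R^o * R^o -> R^o) (e : R) :
  smooth_on setT phi -> 0 < e < 2^-1 ->
  b (I0 R) = c (I0 R) -> b (I1 R) = c (I1 R) ->
  (forall r r' : I01 R, let p := on_line a (phi (val r, val r')) in
    [/\ val r' < e -> p = b (I0 R), 1 - e < val r' -> p = b (I1 R),
        val r < e -> p = b r' & 1 - e < val r -> p = c r']) ->
  thin_homotopic b c.
Proof.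
move=> sphi e01 b0 b1 He; split => //.
pose iota (p : I01 R * I01 R) : square := (val p.1, val p.2).
exists (fun p => on_line a (phi (iota p))).
have phic : continuous phi by move=> x; exact: (sphi 0%N x I).
have ac p : chart_at (p : square) sqchart.
  by split => //; exists (id_chart R^o) => //; exists (id_chart R^o).
have phiE : phi \o chart_inv sqchart = phi by apply/funext => -[].
have sg p : smooth_at (on_line a \o phi : square -> M) p.
  apply: (smooth_at_comp_line (ac p)); first exact: phic.
    by rewrite phiE.
  exact: on_line_smooth.
have ext p :
    local_extension iota (fun p => on_line a (phi (iota p))) p (on_line a \o phi).
  by split; [exact: sg|near=> q => s <-].
split.
- by move=> p; exists (on_line a \o phi : square -> M); exact: ext.
- move=> p; exists (on_line a \o phi); split; first exact: ext.
  have [_ [d [psi [[ad _] cpsi [U [oU Up] sU]]]]] := on_line_smooth a (phi (iota p)).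
  have dE : d = id_chart R^o by exact: ad.
  subst d.
  exists sqchart, psi; split => //.
  have -> : @local_rep R _ _ square M sqchart psi (on_line a \o phi)
      = (psi \o on_line a) \o phi.
    by apply/funext => -[].
  apply: rank_through_line.
    by have [+ _] := sphi 1%N; apply.
  by have [+ _] := sU 1%N; apply; exact: Up.
- by exists e; split => // r r'; exact: (He r r').
Unshelve. all: by end_near. Qed.

End ThinReparametrization.

(** * The thin homotopies behind the unit and inverse laws *)

Section BasicThinHomotopies.
Variables (R : realType) (M : manifold R).

Lemma smooth_fst (u : R^o -> R^o) : smooth_on setT u ->
  smooth_on setT (fun x : R^o * R^o => u x.1).
Proof.
move=> su k; apply: (@Ck_comp _ _ _ k setT fst u openT _ (su k)).
by apply: (@Ck_linear _ _ _ _ _ fst) => x; exact: cvg_fst.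
Qed.

Lemma smooth_snd (u : R^o -> R^o) : smooth_on setT u ->
  smooth_on setT (fun x : R^o * R^o => u x.2).
Proof.
move=> su k; apply: (@Ck_comp _ _ _ k setT snd u openT _ (su k)).
by apply: (@Ck_linear _ _ _ _ _ snd) => x; exact: cvg_snd.
Qed.

Lemma thin_homotopic_cst (x : M) (b c : I01 R -> M) :
  (forall r, b r = x) -> (forall r, c r = x) -> thin_homotopic b c.
Proof.
move=> bx cx.
apply: (@thin_homotopic_reparam _ _ (const_path x) _ _ (fun=> 0) 4^-1).
- by move=> k; exact: Ck_cst.
- by apply/andP; split; lra.
- by rewrite bx cx.
- by rewrite bx cx.
- by move=> r r' /=; rewrite !bx cx.
Qed.

(** Constant paths before and after [a] can be absorbed: the padded path is [r' |-> a
    (4 r' - 2)], with [a] extended by constants, and it is joined to [a] by the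
    interpolation of [r'] and [4 r' - 2]. Near [0] and [1] both parameters lie in
    the region where [a] rests. *)
Lemma thin_homotopic_pad (a : spath M) (u v : I01 R -> M) :
  (forall r, u r = a (I1 R)) -> (forall r, v r = a (I0 R)) ->
  thin_homotopic a (path_cat (path_cat (path_rev u) a) v).
Proof.
move=> u1 v0.
have [e [/andP[e0 e2] a0 a1]] := on_line_sitting a.
have catE (r : I01 R) : path_cat (path_cat (path_rev u) a) v r
    = on_line a (4 * val r - 2).
  rewrite path_cat_on_line; case: r => r /= /andP[r0 r1]; case: leP => r2.
    by rewrite /on_line v0 -/(on_line a _) a0//; lra.
  rewrite -on_line_toI; last by apply/andP; split; lra.
  rewrite path_cat_on_line toI_val; last by apply/andP; split; lra.
  case: leP => r3; first by congr (on_line a _); ring.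
  by rewrite /on_line /path_rev u1 -/(on_line a _) a1//; lra.
have [|S [sS S01 S0 S1]] := @smooth_step R (3^-1) (2^-1); first by lra.
(* [4 r' - 2 <= r'] exactly when [r' <= 2/3]: with [d <= 1/3] the interpolated
   parameter stays below [r'] at the beginning and above it at the end. *)
pose d : R := Num.min e 3^-1.
have de : d <= e by rewrite ge_min lexx.
have d3 : d <= 3^-1 by rewrite ge_min lexx orbT.
have d0 : 0 < d by rewrite lt_min e0 invr_gt0 ltr0n.
apply: (@thin_homotopic_reparam _ _ a _ _
  (fun x => x.2 + S x.1 *: (3 * x.2 + (- 2) : R^o)) d).
- move=> k; apply: CkD; first exact: openT.
    by apply: (@Ck_linear _ _ _ _ _ snd) => x; exact: cvg_snd.
  apply: Ck_scale; first exact: openT.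
    exact: smooth_fst.
  by apply: (@smooth_snd (fun x => 3 * x + (- 2))) => k'; exact: Ck_affine.
- by apply/andP; split; lra.
- by rewrite catE /= -[LHS](a0 (4 * 0 - 2))//; lra.
- by rewrite catE /= -[LHS](a1 (4 * 1 - 2))//; lra.
- move=> r r' /=; have /= /andP[s0 s1] := S01 (val r).
  rewrite /GRing.scale /=; split=> h.
  + by rewrite a0//; nra.
  + by rewrite a1//; nra.
  + by rewrite S0 ?mul0r ?addr0 ?on_line_val//; lra.
  + by rewrite S1 ?mul1r ?catE /=; [congr (on_line a _); ring|lra].
Qed.

Lemma on_line_rev (a : I01 R -> M) (x : R) : 0 <= x <= 1 ->
  on_line (path_rev a) x = on_line a (1 - x).
Proof.
move=> /andP[x0 x1]; rewrite -on_line_toI ?x0// /path_rev toI_val ?x0//.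
by rewrite on_line_toI//; apply/andP; split; lra.
Qed.

(** A path followed by its reverse is [a] composed with the tent function
    [min (2 r') (2 - 2 r')].  Smoothing the tent around its peak does not
    change the composite, because [a] rests near its end; the smoothed tent is then
    contracted to [0] by a factor that decreases from 1 to 0. *)
Lemma thin_homotopic_cancel (a : spath M) (c : I01 R -> M) :
  (forall r, c r = a (I0 R)) -> thin_homotopic (path_cat (path_rev a) a) c.
Proof.
move=> c0.
have [e [/andP[e0 e2] a0 a1]] := on_line_sitting a.
have lowE (r : I01 R) : val r <= 2^-1 ->
    path_cat (path_rev a) a r = on_line a (2 * val r).
  by rewrite path_cat_on_line => ->.
have highE (r : I01 R) : 2^-1 < val r ->
    path_cat (path_rev a) a r = on_line a (2 - 2 * val r).
  rewrite path_cat_on_line; case: r => r /= /andP[r0 r1] r2.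
  rewrite leNgt r2 /= on_line_rev; last by apply/andP; split; lra.
  by congr (on_line a _); ring.
have [|S [sS S01 S0 S1]] := @smooth_step R (3^-1) (2^-1); first by lra.
(* within [e / 4] of the middle, both sides of the tent are above [1 - e] *)
have [|T [sT T01 T0 T1]] := @smooth_step R (2^-1 - e / 4) (2^-1 + e / 4); first by lra.
pose d : R := e / 2.
apply: (@thin_homotopic_reparam _ _ a _ _
  (fun x => (-1 * S x.1 + 1 : R^o) *:
    (2 * x.2 + 0 + T x.2 *: (- 4 * x.2 + 2 : R^o) : R^o)) d).
- move=> k; apply: Ck_scale; first exact: openT.
    apply: (@smooth_fst (fun x => -1 * S x + 1)) => k'.
    exact: (@Ck_comp _ _ _ k' setT S (fun x => -1 * x + 1) openT (sS k')
      (Ck_affine k' _ _)).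
  apply: (@smooth_snd (fun x => 2 * x + 0 + T x *: (- 4 * x + 2 : R^o))) => k'.
  apply: CkD; [exact: openT|exact: Ck_affine|].
  by apply: Ck_scale; [exact: openT|exact: sT|exact: Ck_affine].
- by apply/andP; split; rewrite /d; lra.
- by rewrite lowE /= ?c0 ?a0//; lra.
- by rewrite highE /= ?c0 ?a0//; lra.
- have b0 : path_cat (path_rev a) a (I0 R) = a (I0 R).
    by rewrite lowE /= ?a0//; lra.
  have b1 : path_cat (path_rev a) a (I1 R) = a (I0 R).
    by rewrite highE /= ?a0//; lra.
  move=> r r' /=; have /= /andP[s0 s1] := S01 (val r).
  have /= /andP[t0 t1] := T01 (val r').
  have /= /andP[p0 p1] := valP r'.
  rewrite /GRing.scale /= b0 b1 c0 /d; split=> h.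
  + by rewrite a0// T0; [nra|lra].
  + by rewrite a0// T1; [nra|lra].
  + rewrite S0; last lra.
    rewrite mulr0 add0r mul1r.
    have [/= l|/= l] := leP (val r') (2^-1 - e / 4).
      by rewrite T0// lowE /=; [congr (on_line a _); ring|rewrite /=; lra].
    have [/= u|/= u] := leP (2^-1 + e / 4) (val r').
      by rewrite T1// highE /=; [congr (on_line a _); ring|rewrite /=; lra].
    (* at the peak of the tent, [a] is at rest on both sides of the equation *)
    rewrite a1; last nra.
    have [/= m|/= m] := leP (val r') 2^-1; [rewrite lowE//|rewrite highE//].
      by rewrite a1//=; lra.
    by rewrite a1//=; lra.
  + by rewrite S1; [rewrite mulr1 addNr mul0r a0|lra].
Qed.

End BasicThinHomotopies.

(** * Concatenation and reversal of lazy paths up to thin homotopy *)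

Section LazyCalculus.
Variables (R : realType) (X : lie_groupoid R).

Local Notation X0 := (lie_ob X).
Local Notation X1 := (lie_mor X).
Local Notation s := (gsrc X).
Local Notation t := (gtgt X).
Local Notation lazy_seq := (X1 * seq (spath X0 * X1))%type.
Local Notation final g l := (last g (map snd l)).

Lemma lazy_path_eq (G G' : lazy_path X) : G = G' :> lazy_seq -> G = G'.
Proof.
case: G G' => [K c] [K' c'] /= e; subst K'.
by congr LazyPath; exact: Prop_irrelevance.
Qed.

Lemma gcomp_id_id (x : X0) : gcomp X (gid X x) (gid X x) = gid X x.
Proof. by rewrite -{1}[x](gtgt_id X) gcomp_idl. Qed.

Lemma path_const_ends (T : Type) (a : I01 R -> T) :
  path_const a -> a (I0 R) = a (I1 R).
Proof. by move=> [x ax]; rewrite !ax. Qed.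

Lemma lazy_cat_last g l (K : lazy_seq) : s K.1 = t (final g l) ->
  t (final (lazy_cat g l K).1 (lazy_cat g l K).2) = t (final K.1 K.2).
Proof.
elim: l g => [|[a h] l IH] g /= e; last exact: IH.
by case: K.2 => //=; rewrite gtgt_comp.
Qed.

Lemma lazy_catA g l (K L : lazy_seq) :
  s K.1 = t (final g l) -> s L.1 = t (final K.1 K.2) ->
  lazy_cat (lazy_cat g l K).1 (lazy_cat g l K).2 L
    = lazy_cat g l (lazy_cat K.1 K.2 L).
Proof.
elim: l g => [|[a h] l IH] g /= eK eL; last by rewrite IH.
by case: K eK eL => k [|[b k'] m] //= eK eL; rewrite gcompA.
Qed.

(** Appending acts on the last arrow and composing acts on the first one; they
    interfere only when the list is empty, where the claim is associativity. *)
Lemma lazy_cat_precomp g f l (K : lazy_seq) :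
  s g = t f -> s K.1 = t (final g l) ->
  lazy_cat (gcomp X g f) l K = (gcomp X (lazy_cat g l K).1 f, (lazy_cat g l K).2).
Proof. by case: l => [|[a h] l] //= gf eK; rewrite gcompA. Qed.

Lemma lazy_move_ends (K K' : lazy_seq) : lazy_move K K' -> lazy_chain K.1 K.2 ->
  s K'.1 = s K.1 /\ t (final K'.1 K'.2) = t (final K.1 K.2).
Proof.
elim=> {K K'} /= [g h a l ca|g k a b c x l _|g h a b z l za _|g h h' a l l' m IH].
- move=> [ga ha _]; have e : s h = t g by rewrite ha ga (path_const_ends ca).
  by split; [rewrite gsrc_comp|case: l => [|p l] //=; rewrite gtgt_comp].
- by [].
- move=> [ga ha _]; have zE r : s (z r) = a r by rewrite -za.
  split; first by rewrite gsrc_comp // zE ga.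
  by case: l => [|p l] //=; rewrite gtgt_comp // gtgt_inv zE.
- by move=> [_ _ hl]; have [_ ->] := IH hl.
Qed.

Lemma thin_deformation_from_ends (z : spath X1) (l l' : seq (spath X0 * X1)) :
  thin_deformation_from z l l' ->
  t (final (z (I1 R)) l') = t (final (z (I0 R)) l).
Proof.
elim: l l' z => [|[a g] l IH] [|[a' g'] l'] z //=.
  by move=> [x zx]; rewrite -[LHS]/((t \o z) _) -[RHS]/((t \o z) _) !zx.
by move=> [z' [<- <- _ /IH]].
Qed.

Lemma lazy_step_ends (G G' : lazy_path X) : lazy_step G G' ->
  s (lazy_first G') = s (lazy_first G) /\ t (lazy_last G') = t (lazy_last G).
Proof.
move=> [m|[z [z0 z1 [x zx] zd]]]; first exact: lazy_move_ends m (lazy_valP G).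
have := thin_deformation_from_ends zd; rewrite z0 z1; split => //.
by rewrite /lazy_first -z0 -z1 -[LHS]/((s \o z) _) -[RHS]/((s \o z) _) !zx.
Qed.

Lemma lazy_homotopic_ends (G G' : lazy_path X) : lazy_thin_homotopic G G' ->
  s (lazy_first G') = s (lazy_first G) /\ t (lazy_last G') = t (lazy_last G).
Proof.
elim=> {G G'} [G G' /lazy_step_ends //|//|G G' _ [-> ->] //|].
by move=> G1 G2 G3 _ [<- <-] _ [<- <-].
Qed.

(** A move on the first factor is the same move on the concatenation. When it touches
    the last arrow, associativity reconciles the two orders of composition. *)
Lemma lazy_move_catl (K K' L : lazy_seq) : lazy_move K K' ->
  lazy_chain K.1 K.2 -> s L.1 = t (final K.1 K.2) ->
  lazy_move (lazy_cat K.1 K.2 L) (lazy_cat K'.1 K'.2 L).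
Proof.
elim=> {K K'} /= [g h a l ca|g k a b c x l cE|g h a b z l za bE|g h h' a l l' m IH].
- move=> [ga ha _] eL; have e : s h = t g by rewrite ha ga (path_const_ends ca).
  by rewrite lazy_cat_precomp //; exact: move_const.
- by move=> _ _; exact: move_id cE.
- move=> [ga ha _] eL; have zE r : s (z r) = a r by rewrite -za.
  rewrite [lazy_cat (gcomp _ _ _) _ _]lazy_cat_precomp ?gtgt_inv ?zE //.
  exact: move_transport.
- by move=> [_ _ hl] eL; apply: move_tail => /=; rewrite -!surjective_pairing; exact: IH.
Qed.

Lemma lazy_move_precomp (K K' : lazy_seq) f : lazy_move K K' ->
  lazy_chain K.1 K.2 -> s K.1 = t f ->
  lazy_move (gcomp X K.1 f, K.2) (gcomp X K'.1 f, K'.2).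
Proof.
case=> {K K'} /= [g h a l ca|g k a b c x l cE|g h a b z l za bE|g h h' a l l' m].
- move=> [ga ha _] gf; rewrite -gcompA ?ha ?ga ?(path_const_ends ca) //.
  exact: move_const.
- by move=> _ _; exact: move_id cE.
- move=> [ga ha _] gf; have zE r : s (z r) = a r by rewrite -za.
  rewrite -gcompA ?zE ?ga //; exact: move_transport.
- by move=> _ _; exact: move_tail.
Qed.

Lemma lazy_move_catr g l (K K' : lazy_seq) : lazy_move K K' ->
  lazy_chain K.1 K.2 -> s K.1 = t (final g l) ->
  lazy_move (lazy_cat g l K) (lazy_cat g l K').
Proof.
move=> m cK; elim: l g => [|[a h] l IH] g /= e; first exact: lazy_move_precomp.
by apply: move_tail => /=; rewrite -!surjective_pairing; exact: IH.
Qed.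

(** The constant deformation: the path demanded by the definition is then [a] padded
    with constants. *)
Lemma thin_deformation_from_refl g (l : seq (spath X0 * X1)) : lazy_chain g l ->
  thin_deformation_from (const_path g) l l.
Proof.
elim: l g => [|[a h] l IH] g /=; first by move=> _; exists (t g).
move=> [ga ha hl]; exists (const_path h); split => //; last exact: IH.
by apply: thin_homotopic_pad => r /=.
Qed.

Lemma thin_deformation_refl (G : lazy_path X) : thin_deformation G G.
Proof.
exists (const_path G.1); split => //; first by exists (s G.1).
exact: thin_deformation_from_refl (lazy_valP G).
Qed.

(** Concatenation with a constant path between the two factors instead of a composite
    arrow.  It is equivalent to [lazy_cat], and unlike it leaves all arrows intact, so
    that deformations of the factors can be juxtaposed without composing paths of
    arrows. *)
Definition lazy_junction (K L : lazy_seq) (x : X0) : lazy_seq :=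
  (K.1, K.2 ++ (const_path x, L.1) :: L.2).

Lemma lazy_junction_chain K L x : lazy_chain K.1 K.2 -> lazy_chain L.1 L.2 ->
  t (final K.1 K.2) = x -> s L.1 = x ->
  lazy_chain (lazy_junction K L x).1 (lazy_junction K L x).2.
Proof.
case: K => g l /=; elim: l g => [|[a h] l IH] g /=; first by [].
by move=> [ga ha hl] cL e eL; split => //; exact: IH.
Qed.

Lemma move_junction K L x : t (final K.1 K.2) = x -> s L.1 = x ->
  lazy_move (lazy_junction K L x) (lazy_cat K.1 K.2 L).
Proof.
case: K => g l /=; elim: l g => [|[a h] l IH] g /= e eL.
  by apply: move_const; exists x.
by apply: move_tail; have := IH h e eL; rewrite [X in lazy_move _ X]surjective_pairing.
Qed.

(** The hypotheses make [t \o z] at the end of the first deformation and [s \o w]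
    constant at [x], so at the junction one compares constant paths only. *)
Lemma thin_deformation_from_junction (z w : spath X1)
    (l l' m m' : seq (spath X0 * X1)) (x : X0) :
  thin_deformation_from z l l' -> thin_deformation_from w m m' ->
  path_const (s \o w) -> t (final (z (I0 R)) l) = x -> s (w (I0 R)) = x ->
  thin_deformation_from z (l ++ (const_path x, w (I0 R)) :: m)
    (l' ++ (const_path x, w (I1 R)) :: m').
Proof.
move=> zl wm [y sw] zx wx; have yx : y = x by rewrite -wx -(sw (I0 R)).
subst y; elim: l l' z zl zx => [|[a g] l IH] [|[a' g'] l'] z //=.
  move=> [y tz] zx; have yx : y = x by rewrite -zx -(tz (I0 R)).
  subst y; exists w; split => //; apply: (@thin_homotopic_cst _ _ x) => // r.
  rewrite /path_cat; case: ifP => _; first exact: tz.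
  by case: ifP => _ //; rewrite /path_rev.
move=> [z' [<- <- th zl]] zx; exists z'; split => //; exact: IH.
Qed.

(** Open the junction, deform both factors side by side, and close it again. *)
Lemma lazy_comp_deformation (G1 G2 H1 H2 : lazy_path X)
    (e1 : s (lazy_first H1) = t (lazy_last G1))
    (e2 : s (lazy_first H2) = t (lazy_last G2)) :
  thin_deformation G1 G2 -> thin_deformation H1 H2 ->
  lazy_thin_homotopic (lazy_comp e1) (lazy_comp e2).
Proof.
move=> dG dH; have [sH _] := lazy_step_ends (or_intror dH).
have [_ tG] := lazy_step_ends (or_intror dG).
pose J1 := LazyPath
  (lazy_junction_chain (lazy_valP G1) (lazy_valP H1) (esym e1) erefl).
have e3 : t (lazy_last G2) = s (lazy_first H1) by rewrite tG.
pose J2 := LazyPath (lazy_junction_chain (lazy_valP G2) (lazy_valP H2) e3 sH).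
apply: (rst_trans _ _ _ J1).
  apply/rst_sym/rst_step; left; exact: move_junction.
apply: (rst_trans _ _ _ J2); last first.
  by apply: rst_step; left; exact: move_junction.
apply: rst_step; right.
move: dG dH => [z [z0 z1 sz zd]] [w [w0 w1 sw wd]].
exists z; split => //=; rewrite -w0 -w1.
by apply: thin_deformation_from_junction => //; [rewrite z0 e1|rewrite w0].
Qed.

Lemma lazy_comp_congl (H G G' : lazy_path X) : lazy_thin_homotopic G G' ->
  forall (e : s (lazy_first H) = t (lazy_last G))
    (e' : s (lazy_first H) = t (lazy_last G')),
  lazy_thin_homotopic (lazy_comp e) (lazy_comp e').
Proof.
elim=> {G G'} [G G' [m|d]|G|G G' _ IH|G1 G2 G3 h12 IH12 _ IH23] e e'.
- by apply: rst_step; left; exact: lazy_move_catl m (lazy_valP G) e.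
- exact: lazy_comp_deformation d (thin_deformation_refl H).
- by rewrite (Prop_irrelevance e e'); exact: rst_refl.
- by apply: rst_sym; exact: IH.
- have [_ t12] := lazy_homotopic_ends h12.
  have e2 : s (lazy_first H) = t (lazy_last G2) by rewrite t12.
  exact: rst_trans (IH12 e e2) (IH23 e2 e').
Qed.

Lemma lazy_comp_congr (G H H' : lazy_path X) : lazy_thin_homotopic H H' ->
  forall (e : s (lazy_first H) = t (lazy_last G))
    (e' : s (lazy_first H') = t (lazy_last G)),
  lazy_thin_homotopic (lazy_comp e) (lazy_comp e').
Proof.
elim=> {H H'} [H H' [m|d]|H|H H' _ IH|H1 H2 H3 h12 IH12 _ IH23] e e'.
- by apply: rst_step; left; exact: lazy_move_catr m (lazy_valP H) e.
- exact: lazy_comp_deformation (thin_deformation_refl G) d.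
- by rewrite (Prop_irrelevance e e'); exact: rst_refl.
- by apply: rst_sym; exact: IH.
- have [s12 _] := lazy_homotopic_ends h12.
  have e2 : s (lazy_first H2) = t (lazy_last G) by rewrite s12.
  exact: rst_trans (IH12 e e2) (IH23 e2 e').
Qed.

Lemma lazy_rev_ends g l acc :
  (lazy_rev g l acc).1 = ginv X (final g l) /\
  final (lazy_rev g l acc).1 (lazy_rev g l acc).2 = final (ginv X g) acc.
Proof.
elim: l g acc => [|[a h] l IH] g acc //=.
by have [-> ->] := IH h ((Defs.rev_path a, ginv X g) :: acc).
Qed.

Lemma path_rev_start (a : I01 R -> X0) : path_rev a (I0 R) = a (I1 R).
Proof. by congr a; apply: val_inj; rewrite toI_val subr0 ?lexx ?ler01. Qed.

Lemma path_rev_end (a : I01 R -> X0) : path_rev a (I1 R) = a (I0 R).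
Proof. by congr a; apply: val_inj; rewrite toI_val subrr ?lexx ?ler01. Qed.

(** A lazy path followed by its reverse contracts from the middle: by induction the
    part after [(g, a)] contracts to an identity, which is removed so that [a]
    meets its reverse; the resulting loop is thinly contractible, and the constant
    path left over is removed. The accumulator [acc] makes the induction go
    through for the accumulating definition of [lazy_rev]. *)
Lemma lazy_rev_cancel g l acc (P Q : lazy_path X) :
  lazy_chain g l -> lazy_chain (ginv X g) acc ->
  P = lazy_cat g l (lazy_rev g l acc) :> lazy_seq ->
  Q = (gid X (s g), acc) :> lazy_seq ->
  lazy_thin_homotopic P Q.
Proof.
elim: l g acc P Q => [|[a h] l IH] g acc P Q /=.
  move=> _ _ Pe Qe; suff -> : P = Q by exact: rst_refl.
  by apply: lazy_path_eq; rewrite Pe Qe gcomp_invl.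
move=> [ga ha hl] cacc Pe Qe.
have ra0 := path_rev_start a.
have ra1 := path_rev_end a.
pose acc' := (Defs.rev_path a, ginv X g) :: acc.
have c' : lazy_chain (ginv X h) acc'.
  by split => //=; rewrite ?gtgt_inv ?gsrc_inv ?ha ?ga ?ra0 ?ra1.
have cK : lazy_chain (lazy_cat h l (lazy_rev h l acc')).1
    (lazy_cat h l (lazy_rev h l acc')).2.
  apply: lazy_cat_chain => //; first exact: lazy_rev_chain.
  by have [-> _] := lazy_rev_ends h l acc'; rewrite gsrc_inv.
(* [L] is what the inner part [K] contracts to *)
have cL : lazy_chain (gid X (s h)) acc'.
  by split => //=; rewrite ?gtgt_id ?gsrc_inv ?ha ?ga ?ra0 ?ra1.
pose K := @LazyPath R X _ cK.
pose L := @LazyPath R X (gid X (s h), acc') cL.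
have hKL := IH h acc' K L hl c' erefl erefl.
have cA : lazy_chain g [:: (a, gid X (s h))].
  by split => //=; rewrite gsrc_id.
have eL : s (gid X (s h)) = t (final g [:: (a, gid X (s h))]).
  by rewrite /= gsrc_id gtgt_id.
pose A := @LazyPath R X (g, [:: (a, gid X (s h))]) cA.
have [sKL _] := lazy_homotopic_ends hKL.
have eK : s (lazy_first K) = t (lazy_last A).
  by rewrite -sKL; exact: eL.
(* the contraction [hKL] of the inner part is prefixed by [(g, a, 1)] *)
have hAKL := @lazy_comp_congr A _ _ hKL eK eL.
have PE : P = lazy_comp eK.
  apply: lazy_path_eq; rewrite Pe /=.
  move: sKL; rewrite /lazy_first /= gsrc_id => ->.
  by rewrite gcomp_idr.
rewrite PE; apply: rst_trans hAKL _.
(* what remains is [(g, a, 1, rev a, g^-1, ...)], with [aa] the loop [rev a * a] *)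
have arev : a (I1 R) = Defs.rev_path a (I0 R) by rewrite /= ra0.
pose aa := concat_path arev.
have aa0 : aa (I0 R) = a (I0 R).
  rewrite /= path_cat_on_line /= mulr0 ifT ?invr_ge0 //.
  by rewrite -[0]/(val (I0 R)) on_line_val.
have aa1 : aa (I1 R) = a (I0 R).
  rewrite /= path_cat_on_line /= ifF; last by apply/negbTE; rewrite -ltNge; lra.
  have -> : 2 * 1 - 1 = val (I1 R) :> R by rewrite /=; lra.
  by rewrite on_line_val.
have c1 : lazy_chain g ((aa, ginv X g) :: acc).
  by split => //; rewrite ?gsrc_inv ?aa0 ?aa1 // ga.
have c2 : lazy_chain g ((const_path (t g), ginv X g) :: acc).
  by split => //=; rewrite ?gsrc_inv.
apply: (rst_trans _ _ _ (@LazyPath R X (g, (aa, ginv X g) :: acc) c1)).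
  apply: rst_step; left => /=.
  rewrite gcomp_id_id; exact: move_id.
apply: (rst_trans _ _ _ (@LazyPath R X (g, (const_path (t g), ginv X g) :: acc) c2)).
  apply: rst_step; right; exists (const_path g); split => //; first by exists (s g).
  exists (const_path (ginv X g)); split => //=; last exact: thin_deformation_from_refl.
  apply: thin_homotopic_cancel => r; rewrite -ga.
  rewrite /path_cat; case: ifP => _ //; case: ifP => _ //.
  by rewrite /path_rev /= gsrc_inv.
apply: rst_step; left; rewrite Qe /= -gcomp_invl.
by apply: move_const; exists (t g).
Qed.

Lemma lazy_inv_compl (G : lazy_path X)
    (e : s (lazy_first (lazy_inv G)) = t (lazy_last G)) :
  lazy_thin_homotopic (lazy_comp e) (lazy_unit (s (lazy_first G))).
Proof.
pose U := @LazyPath R X (gid X (s (lazy_first G)), [::]) I.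
apply: (rst_trans _ _ _ U).
  exact: (@lazy_rev_cancel G.1 G.2 [::] (lazy_comp e) U (lazy_valP G) I).
apply/rst_sym/rst_step; left.
have := @move_const R X (gid X (s (lazy_first G))) (gid X (s (lazy_first G)))
  (const_path (s (lazy_first G))) [::].
rewrite gcomp_id_id; apply.
by exists (s (lazy_first G)).
Qed.

Lemma lazy_comp_unitl (G : lazy_path X) x
    (e : s (lazy_first (lazy_unit x)) = t (lazy_last G)) :
  lazy_thin_homotopic (lazy_comp e) G.
Proof.
apply: rst_step; left; move: e; case: G => -[g l] /= c.
rewrite /lazy_first /lazy_last /= gsrc_id => {c}.
elim: l g => [|[a h] l IH] g /= e.
  rewrite e gcomp_idl -{4}(gcomp_idl X g).
  by apply: move_const; exists (t g).
by apply: move_tail; rewrite -surjective_pairing; exact: IH.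
Qed.

Lemma lazy_comp_unitr (G : lazy_path X) x
    (e : s (lazy_first G) = t (lazy_last (lazy_unit x))) :
  lazy_thin_homotopic (lazy_comp e) G.
Proof.
apply: rst_step; left; move: e; case: G => -[g l] /= c.
rewrite /lazy_first /lazy_last /= gtgt_id => {x c}<-.
have := @move_const R X (gid X (s g)) g (const_path (s g)) l.
by rewrite !gcomp_idr; apply; exists (s g).
Qed.

End LazyCalculus.

(** * The groupoid of classes *)

(** In a category where every arrow has a left inverse, left inverses are two-sided
    and unique. The last clause identifies [ginv P f] with any left inverse of
    [f]; for classes of lazy paths this shows that inversion may be computed on
    any representative. *)
Lemma groupoid_of_left_inverses (Ob Mor : Type) (src tgt : Mor -> Ob)
    (idm : Ob -> Mor) (comp : Mor -> Mor -> Mor) (linv : Mor -> Mor) :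
  (forall x, src (idm x) = x) -> (forall x, tgt (idm x) = x) ->
  (forall g f, src g = tgt f -> src (comp g f) = src f) ->
  (forall g f, src g = tgt f -> tgt (comp g f) = tgt g) ->
  (forall h g f, src h = tgt g -> src g = tgt f ->
    comp h (comp g f) = comp (comp h g) f) ->
  (forall f, comp (idm (tgt f)) f = f) -> (forall f, comp f (idm (src f)) = f) ->
  (forall f, src (linv f) = tgt f) -> (forall f, tgt (linv f) = src f) ->
  (forall f, comp (linv f) f = idm (src f)) ->
  exists P : groupoid Ob Mor,
    [/\ gsrc P = src, gtgt P = tgt, gid P = idm, gcomp P = comp &
      forall g f, src g = tgt f -> tgt g = src f -> comp g f = idm (src f) ->
        ginv P f = g].
Proof.
move=> si ti sc tc cA idl idr sv tv vl.
have vr f : comp f (linv f) = idm (tgt f).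
  have e := vl (linv f); rewrite sv in e.
  rewrite -[LHS]idl tc ?tv // -e -cA ?sc ?tc ?sv ?tv //.
  by rewrite [comp (linv f) _]cA ?sv ?tv // vl -[in idm _]tv idl.
exists (Groupoid si ti sc tc cA idl idr sv tv vl vr); split => //= g f sg tg gf.
by rewrite -[RHS]idr sg -vr cA ?tv // gf -tv idl.
Qed.

Section ThinClasses.
Variables (R : realType) (X : lie_groupoid R).
Implicit Types p q : thin_mor X.

Lemma thin_classP (G G' : lazy_path X) :
  thin_class G = thin_class G' <-> lazy_thin_homotopic G G'.
Proof. by split=> [/eqmodP/asboolP //|h]; apply/eqmodP/asboolP. Qed.

Definition thin_repr p : lazy_path X := repr p.

Lemma thin_reprK p : thin_class (thin_repr p) = p.
Proof. exact: reprK. Qed.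

Lemma thin_repr_class (G : lazy_path X) :
  lazy_thin_homotopic G (thin_repr (thin_class G)).
Proof. by apply/thin_classP; rewrite thin_reprK. Qed.

Definition thin_src p := gsrc X (lazy_first (thin_repr p)).
Definition thin_tgt p := gtgt X (lazy_last (thin_repr p)).

Lemma thin_srcE (G : lazy_path X) : thin_src (thin_class G) = gsrc X (lazy_first G).
Proof. by have [] := lazy_homotopic_ends (thin_repr_class G). Qed.

Lemma thin_tgtE (G : lazy_path X) : thin_tgt (thin_class G) = gtgt X (lazy_last G).
Proof. by have [] := lazy_homotopic_ends (thin_repr_class G). Qed.

(** Composition has to be total; the value [p] on non-composable classes is arbitrary. *)
Definition thin_comp q p : thin_mor X :=
  match pselect (thin_src q = thin_tgt p) with
  | left e => thin_class (lazy_comp e)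
  | right _ => p
  end.

Lemma thin_compE (H G : lazy_path X)
    (e : gsrc X (lazy_first H) = gtgt X (lazy_last G)) :
  thin_comp (thin_class H) (thin_class G) = thin_class (lazy_comp e).
Proof.
rewrite /thin_comp; case: pselect => [e'|]; last by rewrite thin_srcE thin_tgtE.
apply/thin_classP.
have e'' : gsrc X (lazy_first H) = gtgt X (lazy_last (thin_repr (thin_class G))).
  by rewrite e -thin_tgtE.
apply: (rst_trans _ _ _ (lazy_comp e'')).
  by apply: lazy_comp_congr; apply: rst_sym; exact: thin_repr_class.
by apply: lazy_comp_congl; apply: rst_sym; exact: thin_repr_class.
Qed.

Lemma lazy_last_comp (H G : lazy_path X)
    (e : gsrc X (lazy_first H) = gtgt X (lazy_last G)) :
  gtgt X (lazy_last (lazy_comp e)) = gtgt X (lazy_last H).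
Proof. exact: lazy_cat_last. Qed.

Lemma lazy_first_comp (H G : lazy_path X)
    (e : gsrc X (lazy_first H) = gtgt X (lazy_last G)) :
  gsrc X (lazy_first (lazy_comp e)) = gsrc X (lazy_first G).
Proof. exact: lazy_cat_src. Qed.

Lemma lazy_first_inv (G : lazy_path X) : lazy_first (lazy_inv G) = ginv X (lazy_last G).
Proof. by have [] := lazy_rev_ends G.1 G.2 [::]. Qed.

Lemma lazy_last_inv (G : lazy_path X) : lazy_last (lazy_inv G) = ginv X (lazy_first G).
Proof. by have [] := lazy_rev_ends G.1 G.2 [::]. Qed.

Lemma thin_compA r q p : thin_src r = thin_tgt q -> thin_src q = thin_tgt p ->
  thin_comp r (thin_comp q p) = thin_comp (thin_comp r q) p.
Proof.
rewrite -(thin_reprK r) -(thin_reprK q) -(thin_reprK p).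
move: (thin_repr r) (thin_repr q) (thin_repr p) => K H G.
rewrite !thin_srcE !thin_tgtE => eKH eHG.
have e1 : gsrc X (lazy_first K) = gtgt X (lazy_last (lazy_comp eHG)).
  by rewrite lazy_last_comp.
have e2 : gsrc X (lazy_first (lazy_comp eKH)) = gtgt X (lazy_last G).
  by rewrite lazy_first_comp.
rewrite (thin_compE eHG) (thin_compE eKH) (thin_compE e1) (thin_compE e2).
congr thin_class; apply: lazy_path_eq; exact: lazy_catA.
Qed.

End ThinClasses.

Theorem proposition4p2 (R : realType) (X : lie_groupoid R) :
  exists P : groupoid (lie_ob X) (thin_mor X),
  [/\ forall G : lazy_path X,
        gsrc P (thin_class G) = gsrc X (lazy_first G),
      forall G : lazy_path X,
        gtgt P (thin_class G) = gtgt X (lazy_last G),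
      forall (G' G : lazy_path X)
          (e : gsrc X (lazy_first G') = gtgt X (lazy_last G)),
        gcomp P (thin_class G') (thin_class G) = thin_class (lazy_comp e),
      forall x : lie_ob X, gid P x = thin_class (lazy_unit x) &
      forall G : lazy_path X, ginv P (thin_class G) = thin_class (lazy_inv G)].
Proof.
pose src := @thin_src R X; pose tgt := @thin_tgt R X.
pose idm x := thin_class (lazy_unit x : lazy_path X).
pose inv (p : thin_mor X) := thin_class (lazy_inv (thin_repr p)).
have srcinv (G : lazy_path X) : gsrc X (lazy_first (lazy_inv G)) = gtgt X (lazy_last G).
  by rewrite lazy_first_inv gsrc_inv.
have tgtinv (G : lazy_path X) : gtgt X (lazy_last (lazy_inv G)) = gsrc X (lazy_first G).
  by rewrite lazy_last_inv gtgt_inv.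
have invl (G : lazy_path X) : thin_comp (thin_class (lazy_inv G)) (thin_class G)
    = idm (gsrc X (lazy_first G)).
  by rewrite (thin_compE (srcinv G)); apply/thin_classP; exact: lazy_inv_compl.
have [||||||||||P [Ps Pt Pi Pc Pv]] :=
  @groupoid_of_left_inverses _ _ src tgt idm (@thin_comp R X) inv.
- by move=> x; rewrite /src thin_srcE /= /lazy_first gsrc_id.
- by move=> x; rewrite /tgt thin_tgtE /= /lazy_last gtgt_id.
- move=> q p; rewrite -(thin_reprK q) -(thin_reprK p) /src /tgt.
  rewrite !thin_srcE thin_tgtE => e.
  by rewrite (thin_compE e) thin_srcE lazy_first_comp.
- move=> q p; rewrite -(thin_reprK q) -(thin_reprK p) /src /tgt.
  rewrite !thin_srcE !thin_tgtE => e.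
  by rewrite (thin_compE e) thin_tgtE lazy_last_comp.
- exact: thin_compA.
- move=> p; rewrite -(thin_reprK p); move: (thin_repr p) => G.
  have e : gsrc X (lazy_first (lazy_unit (gtgt X (lazy_last G))))
      = gtgt X (lazy_last G).
    by rewrite /lazy_first gsrc_id.
  rewrite /tgt thin_tgtE (thin_compE e).
  by apply/thin_classP; exact: lazy_comp_unitl.
- move=> p; rewrite -(thin_reprK p); move: (thin_repr p) => G.
  have e : gsrc X (lazy_first G)
      = gtgt X (lazy_last (lazy_unit (gsrc X (lazy_first G)))).
    by rewrite /lazy_last gtgt_id.
  rewrite /src thin_srcE (thin_compE e).
  by apply/thin_classP; exact: lazy_comp_unitr.
- by move=> p; rewrite /src thin_srcE srcinv.
- by move=> p; rewrite /tgt thin_tgtE tgtinv.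
- by move=> p; rewrite -[in RHS](thin_reprK p) /src thin_srcE -invl thin_reprK.
exists P; rewrite Ps Pt Pi Pc; split.
- exact: thin_srcE.
- exact: thin_tgtE.
- by move=> G' G e; exact: thin_compE.
- by [].
move=> G; apply: Pv.
- by rewrite /src /tgt thin_srcE thin_tgtE srcinv.
- by rewrite /src /tgt thin_srcE thin_tgtE tgtinv.
- by rewrite invl /src thin_srcE.
Qed.
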